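(* Let $n\ge1$ and let $f$ be a non-degenerate alternating form on $\mathbb{F}_q^{2n}$. Define $v_f$ on the chambers of $\mathbb{F}_q^{2n}$ by $v_f(C)=1$ if $C$ is symplectic with respect to $f$ and $v_f(C)=0$ otherwise. Then $v_f$ is an antidesign of $\Gamma_{2n}(q)$ and $\mathds{1}^\top v_f=z_n(q)\prod_{i=1}^n(q^i+1)$.
   Context: A chamber of $\mathbb{F}_q^{2n}$ is a set $C=\{C_1,\dots,C_{2n-1}\}$ of subspaces with $C_1\subset\cdots\subset C_{2n-1}$, $\dim C_i=i$; chambers $C,D$ are opposite if $C_i\cap D_{2n-i}=\{0\}$ for all $i$. $\Gamma_{2n}(q)$ is the graph on chambers with adjacency being oppositeness. Functions on chambers are vectors indexed by chambers, $\mathds{1}$ the all-ones vector. An antidesign is a function $v$ from chambers to $\mathbb{Q}$ with $e^\top v=0$ for all $e$ in the eigenspace of $\Gamma_{2n}(q)$ for its smallest eigenvalue. With $\perp$ the polarity of $f$, a chamber $C$ is symplectic if $C_n$ is totally isotropic and $C_{2n-i}=C_i^\perp$ for $i=1,\dots,n$. $z_n(q)=(q-1)^{-n}\prod_{i=1}^n(q^i-1)$ is the number of chambers of $\mathbb{F}_q^n$. *)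

(* Defs.v *)
From HB Require Import structures.
From mathcomp Require Import all_boot all_order all_algebra.

Set Implicit Arguments.
Unset Strict Implicit.
Unset Printing Implicit Defensive.

Import Order.TTheory GRing.Theory Num.Theory.

Local Open Scope ring_scope.

Section FiniteVspace.
Import VectorInternalTheory.
Variables (F : finFieldType) (vT : vectType F).
HB.instance Definition _ := [Countable of {vspace vT} by <:].
HB.instance Definition _ := [Finite of {vspace vT} by <:].
End FiniteVspace.

Section Chambers.
Variables (F : finFieldType) (d : nat).

(* Ordinals start at 0, so C i is the member of dimension i + 1: the subspace
   written C_j in mathematical notation is the value of C at j - 1. *)
Definition is_chamber (C : {ffun 'I_d.-1 -> {vspace 'rV[F]_d}}) : bool :=
  [forall i : 'I_d.-1, \dim (C i) == i.+1] &&
  [forall i : 'I_d.-1, forall j : 'I_d.-1, (i <= j)%N ==> (C i <= C j)%VS].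

Record chamber := Chamber {
  chamber_fun :> {ffun 'I_d.-1 -> {vspace 'rV[F]_d}};
  chamberP : is_chamber chamber_fun }.

HB.instance Definition _ := [isSub for chamber_fun].
HB.instance Definition _ := [Countable of chamber by <:].
HB.instance Definition _ := [Finite of chamber by <:].

(* rev_ord sends j - 1 to (d - j) - 1, so D (rev_ord i) is D_{d-j} when
   C i is C_j. *)
Definition opposite : rel chamber :=
  fun C D => [forall i, (C i :&: D (rev_ord i) == 0)%VS].

End Chambers.

Section Graphs.
Variables (R : rcfType) (T : finType) (adj : rel T).

Definition adjacency_mx : 'M[R]_#|T| :=
  \matrix_(i, j) (adj (enum_val i) (enum_val j))%:R.

Definition is_smallest_eigenvalue m (A : 'M[R]_m) (l : R) : Prop :=
  eigenvalue A l /\ forall l' : R, eigenvalue A l' -> l <= l'.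

(* eigenspace A l consists of the row vectors e with e *m A = l *: e; it is the
   usual eigenspace, since the adjacency matrix of a graph is symmetric. *)
Definition antidesign (v : T -> rat) : Prop :=
  exists2 l : R, is_smallest_eigenvalue adjacency_mx l &
    forall e : 'rV[R]_#|T|, (e <= eigenspace adjacency_mx l)%MS ->
      \sum_(C : T) e 0 (enum_rank C) * ratr (v C) = 0.

End Graphs.

Section Symplectic.
Variables (F : finFieldType) (n : nat).
Variable f : {skew_symmetric 'rV[F]_(2 * n)}.

(* orthov f U is the subspace of all u with f u w = 0 for every w in U. *)
Definition symplectic (C : chamber F (2 * n)) : bool :=
  [forall i : 'I_(2 * n).-1, (i.+1 == n) ==> (C i <= orthov f (C i))%VS] &&
  [forall i : 'I_(2 * n).-1, (i < n)%N ==> (C (rev_ord i) == orthov f (C i))].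

Definition symplectic_fun (C : chamber F (2 * n)) : rat := (symplectic C)%:R.

End Symplectic.

(* The number of chambers of an n-dimensional space over a field of order q. *)
Definition num_chambers (n q : nat) : rat :=
  (q%:R - 1) ^- n * \prod_(1 <= i < n.+1) (q%:R ^+ i - 1).

(* Main.v *)
Require Import Defs.
From HB Require Import structures.
From mathcomp Require Import all_boot all_order all_algebra.
From mathcomp Require Import finfield zify ring.

(* For a panel type i let T_i be the Hecke operator on chambers, whose matrix is
   the adjacency "differ exactly in the i-th member".  It is symmetric with
   eigenvalues q and -1, and the opposition matrix A is a product of N = d(d-1)/2
   of them (d = 2n).  Since A T_i = T_(d-i) A, an eigenspace of A^2 intersected
   with a T-stable space is a T-stable space K; let k be its dimension and b the
   common rank of the T_i - q on K.  If A^2 = mu on K then taking determinants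
   gives mu^k = q^((k-b) d(d-1)).  A vector killed by all T_i - q is constant
   because the chamber graph is connected, so if K is orthogonal to the constants
   it is the sum of the d-1 images of T_i - q, whence k <= (d-1) b and
   mu <= q^(d(d-2)).  A vector killed by T_i - q for i > 1 depends only on the
   point C_1, so if K is even orthogonal to the space U spanned by the functions
   [u \in C_j] then k <= (d-2) b and mu < q^(d(d-2)).  An explicit eigenvector in
   U shows that -q^(2n(n-1)) is an eigenvalue of A; hence it is the smallest one,
   and its eigenspace annihilates everything orthogonal to U.

   The symplectic group is transitive on nonzero vectors, so a double count shows
   that v_f and the all-one vector have proportional inner products with every
   [u \in C_j]; thus v_f minus a constant is orthogonal to U.  The number of
   symplectic chambers comes from counting bases of totally isotropic n-spaces
   adapted to a flag. *)

Import Order.TTheory GRing.Theory Num.Theory.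
Local Open Scope ring_scope.

Set Implicit Arguments.
Unset Strict Implicit.
Unset Printing Implicit Defensive.

(** * Symmetric Hecke operators *)

Section SymmetricMatrices.
Variable R : realFieldType.

Lemma row_norm_eq0 m (z : 'rV[R]_m) : z *m z^T = 0 -> z = 0.
Proof.
move=> /matrixP /(_ 0 0); rewrite !mxE => /eqP.
rewrite psumr_eq0 => [/allP z0|j _]; last by rewrite mxE -expr2 sqr_ge0.
apply/matrixP => i j; rewrite ord1 !mxE; apply/eqP.
by have := z0 j (mem_index_enum j); rewrite mxE -expr2 sqrf_eq0.
Qed.

Lemma stablemx_orth m p (W : 'M[R]_(p, m)) (X : 'M[R]_m) :
  X^T = X -> stablemx W X -> stablemx (kermx W^T) X.
Proof.
move=> symX /submxP[D WX]; apply/sub_kermxP.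
by rewrite -mulmxA -{1}symX -trmx_mul WX trmx_mul mulmxA mulmx_ker mul0mx.
Qed.

(** Let z in K be orthogonal to the sum S of the images. As z X_i X_i lies in S, symmetry gives (z
    X_i)(z X_i)^T = 0, so every z X_i vanishes and z = 0. Thus K meets the orthogonal complement of
    S trivially, and its rank is at most that of S. *)
Lemma stablemx_sum_im m (I : finType) (P : pred I) (X : I -> 'M[R]_m)
    (K : 'M[R]_m) :
  (forall i, P i -> (X i)^T = X i) -> (forall i, P i -> stablemx K (X i)) ->
  (forall z : 'rV_m, (z <= K)%MS -> (forall i, P i -> z *m X i = 0) -> z = 0) ->
  (K <= \sum_(i | P i) K *m X i)%MS.
Proof.
move=> symX KX K0; set S := (\sum_(i | P i) _)%MS.
have SK : (S <= K)%MS by apply/sumsmx_subP => i Pi; apply: KX.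
suff rKS : (\rank K <= \rank S)%N by rewrite -(mxrank_leqif_sup SK) eqn_leq mxrankS.
suff KS0 : (K :&: kermx S^T)%MS = 0.
  rewrite -(mxrank_mul_ker K S^T) KS0 mxrank0 addn0 -(mxrank_tr S).
  exact: mxrankS (submxMl _ _).
apply/eqP/rowV0P => z; rewrite sub_capmx => /andP[zK /sub_kermxP zS].
apply: K0 => // i Pi; apply: row_norm_eq0; rewrite trmx_mul symX //.
have /submxP[D zXX] : (z *m X i *m X i <= S)%MS.
  apply: submx_trans (sumsmx_sup i Pi (submx_refl _)).
  by apply: submxMr; apply: submx_trans (submxMr _ zK) (KX i Pi).
have -> : z *m X i *m (X i *m z^T) = (z *m (z *m X i *m X i)^T)^T.
  by rewrite trmx_mul trmxK; exact: mulmxA.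
by rewrite zXX (trmx_mul D) mulmxA zS mul0mx trmx0.
Qed.

Lemma mxrank_sum_im m (I : finType) (P : pred I) (K : 'M[R]_m) (b : nat)
    (Y : I -> 'M[R]_m) :
  (forall i, P i -> \rank (Y i) = b) -> (K <= \sum_(i | P i) Y i)%MS ->
  (\rank K <= #|[pred i | P i]| * b)%N.
Proof.
move=> rY /mxrankS /leq_trans; apply.
apply: leq_trans (mxrank_sum_leqif _) _ => /=.
by rewrite (eq_bigr (fun=> b)) // sum_nat_const.
Qed.

End SymmetricMatrices.

(** * Determinants of operators annihilated by a quadratic polynomial *)

Section RestrictedDeterminants.
Variable R : realFieldType.

(** Sylvester's determinant identity, cleared of denominators so that c need not be invertible; both
    sides come from the block matrix [Z]. *)
Lemma det_scalar_add_mulmx k b (c : R) (L : 'M_(k, b)) (M : 'M_(b, k)) :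
  c ^+ b * \det (c%:M + L *m M) = c ^+ k * \det (c%:M + M *m L).
Proof.
set Z := block_mx (1%:M : 'M_b) (- M) L (c%:M : 'M_k).
have detZ : \det Z = \det (c%:M + L *m M).
  have detM : \det (block_mx 1%:M M 0 1%:M : 'M[R]_(b + k)) = 1.
    by rewrite det_ublock !det1 mulr1.
  rewrite -[LHS]mulr1 -detM.
  rewrite -det_mulmx mulmx_block !mulmx1 !mulmx0 !mul1mx !addr0 subrr.
  by rewrite det_lblock det1 mul1r addrC.
have := det_mulmx (block_mx c%:M M 0 1%:M : 'M_(b + k)) Z.
rewrite mulmx_block !mulmx1 !mul1mx !mul0mx !add0r mulmxN mul_scalar_mx.
rewrite mul_mx_scalar addNr det_lblock det_ublock det1 mulr1 detZ !det_scalar.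
by move=> <-; rewrite mulrC.
Qed.

(** The eigenvalues are c and -1, and c has multiplicity k - rank (t - c). Instead of diagonalising,
    factor t - c = L M with both factors of full rank; then M L = -(c + 1), and Sylvester's identity
    reduces det t to the determinant of a scalar matrix. *)
Lemma det_quadratic k (c : R) (t : 'M[R]_k) :
  0 < c -> (t - c%:M) *m (t + 1%:M) = 0 ->
  `|\det t| = c ^+ (k - \rank (t - c%:M)).
Proof.
move=> c0 tq; set X := t - c%:M; set b := \rank X.
have bk : (b <= k)%N := rank_leq_row _.
have XE : X = col_base X *m row_base X by rewrite mulmx_base.
have RL : row_base X *m col_base X = - (c + 1)%:M.
  have XX : X *m X = X *m (- (c + 1)%:M).
    have Xt : X = t + 1%:M - (c + 1)%:M.
      by rewrite /X raddfD opprD addrACA subrr addr0.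
    by rewrite [in X in _ *m X = _]Xt mulmxBr tq sub0r mulmxN.
  apply: (row_free_inj (row_base_free X)); apply: (row_full_inj (col_base_full X)).
  have := XX; rewrite {1 2 3}XE !mulmxA => ->.
  by rewrite !mulmxN !mul_mx_scalar !mulNmx -!scalemxAl.
have := det_scalar_add_mulmx c (col_base X) (row_base X).
have cRL : c%:M - (c + 1)%:M = (- 1)%:M :> 'M_b.
  by rewrite -raddfB opprD addrA subrr add0r.
have cX : c%:M + X = t by rewrite addrC subrK.
rewrite -XE RL cRL cX det_scalar.
move=> /(congr1 Num.norm); rewrite !normrM !normrX normrN1 expr1n mulr1 gtr0_norm //.
rewrite -/b -{2}(subnKC bk) exprD => /mulfI; apply.
by rewrite expf_neq0 ?gt_eqF.
Qed.

End RestrictedDeterminants.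

(** * Abstract Hecke operators on a stable subspace *)

Section HeckeRestriction.
Variables (R : realFieldType) (m d : nat) (q : R).
(** [A k] models the operator of the longest word in s_1, .., s_(k-1), and [G k j] the product T_j
    .. T_k A_k. The hypotheses therefore say that A_(k+1) = T_1 .. T_k A_k. *)
Variables (T A : nat -> 'M[R]_m) (G : nat -> nat -> 'M[R]_m).
Hypothesis q_gt1 : 1 < q.
Hypothesis T_sym : forall i, (0 < i < d)%N -> (T i)^T = T i.
Hypothesis T_quadratic :
  forall i, (0 < i < d)%N -> (T i - q%:M) *m (T i + 1%:M) = 0.
Hypothesis A1 : A 1 = 1%:M.
Hypothesis G_start : forall k, (0 < k < d)%N -> G k k.+1 = A k.
Hypothesis G_end : forall k, (0 < k < d)%N -> G k 1 = A k.+1.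
Hypothesis G_step :
  forall k j, (0 < j <= k)%N -> (k < d)%N -> G k j = T j *m G k j.+1.
Hypothesis T_comm_A :
  forall k i, (0 < i < k)%N -> (k <= d)%N -> T i *m A k = A k *m T (k - i).

Section Products.
Variable P : 'M[R]_m -> Prop.
Hypothesis P1 : P 1%:M.
Hypothesis PT : forall i X, (0 < i < d)%N -> P X -> P (T i *m X).

(** An induction principle: [A k] is a product of operators T_i. *)
Lemma A_closed k : (0 < k <= d)%N -> P (A k).
Proof.
elim: k => // -[|k] IHk kd; first by rewrite A1.
have {IHk} PAk : P (A k.+1) by apply: IHk; lia.
(* Here j counts the factors T already placed in front of [A k.+1]. *)
suff PG j : (j <= k.+1)%N -> P (G k.+1 (k.+2 - j)).
  by rewrite -G_end; [have := PG k.+1 (leqnn _); rewrite subSnn | lia].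
elim: j => [|j IHj] jk; first by rewrite subn0 G_start //; lia.
rewrite G_step; try lia; have -> : (k.+2 - j.+1).+1 = (k.+2 - j)%N by lia.
by apply: PT; [lia | apply: IHj; lia].
Qed.

End Products.

Section Restriction.
Variable K : 'M[R]_m.
Hypothesis KT : forall i, (0 < i < d)%N -> stablemx K (T i).

Lemma stablemx_A k : (0 < k <= d)%N -> stablemx K (A k).
Proof.
apply: (A_closed (P := fun X => stablemx K X)); first exact: stablemxC.
by move=> i X /KT; apply: stablemxM.
Qed.

(** [rT i] is the matrix of T_i restricted to K in the basis [B]; its size is the rank of K, so its
    determinant is that of the restriction. *)
Local Notation B := (row_base K).
Local Notation rT i := (conjmx B (T i)).

Lemma conjmx_T_quadratic i : (0 < i < d)%N ->
  (rT i - q%:M) *m (rT i + 1%:M) = 0.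
Proof.
move=> id; apply: (row_free_inj (row_base_free K)).
have BT : rT i *m B = B *m T i by rewrite mulmxKpV ?stablemx_row_base ?KT.
have BTD c : (rT i + c%:M) *m B = B *m (T i + c%:M).
  by rewrite mulmxDl BT mulmxDr scalar_mxC.
have BTB c : (rT i - c%:M) *m B = B *m (T i - c%:M).
  by rewrite mulmxBl BT mulmxBr scalar_mxC.
by rewrite mul0mx -mulmxA BTD mulmxA BTB -mulmxA T_quadratic // mulmx0.
Qed.

Lemma mxrank_conjmx_T i : (0 < i < d)%N ->
  \rank (rT i - q%:M) = \rank (K *m (T i - q%:M)).
Proof.
move=> id; rewrite -(mxrankMfree _ (row_base_free K)) mulmxBl.
rewrite mulmxKpV ?stablemx_row_base ?KT // -scalar_mxC -mulmxBr.
by rewrite (eqmxMr _ (eq_row_base K)).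
Qed.

Lemma det_conjmx_T i : (0 < i < d)%N ->
  `|\det (rT i)| = q ^+ (\rank K - \rank (K *m (T i - q%:M))).
Proof.
move=> id; rewrite -mxrank_conjmx_T //.
by apply: det_quadratic (conjmx_T_quadratic id); apply: lt_trans q_gt1.
Qed.

Lemma det_conjmx_A_neq0 k : (0 < k <= d)%N -> \det (conjmx B (A k)) != 0.
Proof.
move=> kd; suff [] : stablemx B (A k) /\ \det (conjmx B (A k)) != 0 by [].
apply: (A_closed (P := fun X => stablemx B X /\ \det (conjmx B X) != 0)) => //.
  by rewrite stablemxC conjmx_scalar ?row_base_free // det1 oner_neq0.
move=> i X id [BX dX]; have BT : stablemx B (T i) by rewrite stablemx_row_base KT.
split; first exact: stablemxM.
rewrite conjmxM ?inE // det_mulmx mulf_neq0 // -normr_eq0 det_conjmx_T //.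
by rewrite expf_neq0 // gt_eqF // (lt_trans _ q_gt1).
Qed.

(* T_i and T_1 are conjugate under the longest element of the parabolic
   subgroup generated by s_1, .., s_i. *)
Lemma mxrank_im_T i : (0 < i < d)%N ->
  \rank (K *m (T i - q%:M)) = \rank (K *m (T 1 - q%:M)).
Proof.
move=> id; have d1 : (0 < 1 < d)%N by lia.
have [iS id' kd] : [/\ (0 < i < i.+1)%N, (i.+1 <= d)%N & (0 < i.+1 <= d)%N] by split; lia.
have stB X : stablemx K X -> stablemx B X by rewrite stablemx_row_base.
have := congr1 (fun X => `|\det (conjmx B X)|) (T_comm_A iS id').
rewrite !conjmxM ?inE ?stB ?KT ?stablemx_A ?subSnn // !det_mulmx !normrM mulrC.
move/mulfI; rewrite normr_eq0 det_conjmx_A_neq0 // => /(_ isT).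
rewrite !det_conjmx_T // => /(ieexprIn _ _).
have q0 : 0 < q by apply: lt_trans q_gt1.
rewrite q0 gt_eqF // => /(_ isT isT) rk.
have r1 := mxrankM_maxl K (T i - q%:M); have r2 := mxrankM_maxl K (T 1 - q%:M).
by rewrite -(subKn r1) rk subKn.
Qed.

(** [A k] is a product of 'C(k, 2) operators T_i, whose determinants on K all have the same absolute
    value by [mxrank_im_T]. *)
Lemma norm_det_conjmx_A k : (0 < k <= d)%N ->
  `|\det (conjmx B (A k))| =
    (q ^+ (\rank K - \rank (K *m (T 1 - q%:M)))) ^+ 'C(k, 2).
Proof.
set tau := q ^+ _; elim: k => // -[|k] IHk kd.
  by rewrite A1 conjmx_scalar ?row_base_free // det1 normr1.
have {}IHk : `|\det (conjmx B (A k.+1))| = tau ^+ 'C(k.+1, 2) by apply: IHk; lia.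
suff PG j : (j <= k.+1)%N -> stablemx B (G k.+1 (k.+2 - j)) /\
   `|\det (conjmx B (G k.+1 (k.+2 - j)))| = tau ^+ ('C(k.+1, 2) + j).
  rewrite -G_end; last by lia.
  by have [_] := PG k.+1 (leqnn _); rewrite subSnn => ->; rewrite [in RHS]binS bin1.
elim: j => [|j IHj] jk.
  rewrite subn0 addn0 G_start; last by lia.
  by rewrite stablemx_row_base; split=> //; apply: stablemx_A; lia.
rewrite G_step; try lia; have -> : (k.+2 - j.+1).+1 = (k.+2 - j)%N by lia.
have [|BG dG] := IHj; first by lia.
have id : (0 < k.+2 - j.+1 < d)%N by lia.
have BT : stablemx B (T (k.+2 - j.+1)) by rewrite stablemx_row_base KT.
split; first exact: stablemxM.
rewrite conjmxM ?inE // det_mulmx normrM dG det_conjmx_T // mxrank_im_T //.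
by rewrite addnS exprS.
Qed.

Variable mu : R.
Hypothesis mu_ge0 : 0 <= mu.
Hypothesis d_gt0 : (0 < d)%N.
Hypothesis KA : K *m (A d *m A d) = mu *: K.

Lemma full_twist_eigenvalue :
  mu ^+ \rank K = q ^+ ((\rank K - \rank (K *m (T 1 - q%:M))) * (d * d.-1)).
Proof.
have dd : (0 < d <= d)%N by rewrite d_gt0 /=.
have BA : stablemx B (A d) by rewrite stablemx_row_base stablemx_A.
have : conjmx B (A d *m A d) = mu%:M.
  apply: (row_free_inj (row_base_free K)).
  rewrite mulmxKpV ?stablemxM // mul_scalar_mx.
  have /submxP[D ->] : (B <= K)%MS by rewrite eq_row_base.
  by rewrite -[LHS]mulmxA KA scalemxAr.
rewrite conjmxM ?inE // => /(congr1 (fun X => `|\det X|)).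
rewrite det_mulmx normrM norm_det_conjmx_A // det_scalar normrX ger0_norm // => <-.
rewrite -exprMn -expr2 -!exprM; congr (_ ^+ (_ * _)).
by rewrite mulnC; have := bin_ffact d 2; rewrite ffactnS ffactn1.
Qed.

(** By [stablemx_sum_im], K is contained in the sum of the images of T_i - q for t < i < d: at most
    d - 1 - t spaces, all of the same rank. *)
Lemma mxrank_le_im t :
  (forall z : 'rV_m, (z <= K)%MS ->
     (forall i, (t < i < d)%N -> z *m T i = q *: z) -> z = 0) ->
  (\rank K <= (d.-1 - t) * \rank (K *m (T 1 - q%:M)))%N.
Proof.
move=> K0; pose P (i : 'I_d) := (t < i)%N.
have Pd i : P i -> (0 < i < d)%N by rewrite /P; have := ltn_ord i; lia.
have cardP : (#|[pred i | P i]| <= d.-1 - t)%N.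
  have -> : (d.-1 - t)%N = size (iota t.+1 (d.-1 - t)) by rewrite size_iota.
  rewrite cardE -(size_map val); apply: uniq_leq_size.
    by rewrite map_inj_uniq ?enum_uniq //; apply: val_inj.
  move=> j /mapP[i]; rewrite mem_enum !inE /P => ti ->.
  by rewrite mem_iota; have := ltn_ord i; rewrite /=; lia.
apply: leq_trans (leq_mul cardP (leqnn _)).
apply: (@mxrank_sum_im R m 'I_d P K _ (fun i => K *m (T i - q%:M))).
  by move=> i /Pd; apply: mxrank_im_T.
apply: stablemx_sum_im => [i /Pd id|i /Pd id|z zK z0].
- by rewrite linearB /= T_sym // tr_scalar_mx.
- by rewrite stablemxD ?KT // stablemxN stablemxC.
- apply: K0 => // i ti; have id : (i < d)%N by lia.
  have := z0 (Ordinal id); rewrite /P /= => /(_ _)/eqP.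
  by rewrite mulmxBr mul_mx_scalar subr_eq0 => /(_ _)/eqP; apply; lia.
Qed.

(** With k = rank K, the bound k <= (d - 1) b gives (k - b)(d - 1) <= k (d - 2); multiply by d and
    compare k-th powers. *)
Lemma full_twist_eigenvalue_le :
  (forall z : 'rV_m, (z <= K)%MS ->
     (forall i, (0 < i < d)%N -> z *m T i = q *: z) -> z = 0) ->
  K != 0 -> mu <= q ^+ (d * d.-2).
Proof.
move=> /mxrank_le_im; rewrite subn0 -mxrank_eq0 => rK K0.
rewrite -(ler_pXn2r (n := \rank K)) ?lt0n ?nnegrE ?exprn_ge0 //; last first.
  by rewrite ltW // (lt_trans _ q_gt1).
rewrite full_twist_eigenvalue -exprM ler_eXn2l //.
case: d rK d_gt0 => // -[|e] /= rK _; first by lia.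
nia.
Qed.

(** Now k <= (d - 2) b, and since k > 0 this makes (k - b)(d - 1) < k (d - 2) strict. *)
Lemma full_twist_eigenvalue_lt :
  (forall z : 'rV_m, (z <= K)%MS ->
     (forall i, (1 < i < d)%N -> z *m T i = q *: z) -> z = 0) ->
  K != 0 -> mu < q ^+ (d * d.-2).
Proof.
move=> /mxrank_le_im; rewrite -mxrank_eq0 => rK K0.
rewrite -(ltr_pXn2r (n := \rank K)) ?lt0n ?nnegrE ?exprn_ge0 //; last first.
  by rewrite ltW // (lt_trans _ q_gt1).
rewrite full_twist_eigenvalue -exprM ltr_eXn2l //.
case: d rK d_gt0 => // -[|e] /= rK _; first by lia.
nia.
Qed.

End Restriction.

(** * The smallest eigenvalue and its eigenspace *)

Variables (p : nat) (U : 'M[R]_(p, m)) (rho : R).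
Hypothesis d_gt0 : (0 < d)%N.
Hypothesis A_sym : (A d)^T = A d.
Hypothesis const_T : forall i, (0 < i < d)%N ->
  const_mx 1 *m T i = q *: const_mx 1 :> 'rV_m.
Hypothesis T_fixed_const : forall z : 'rV_m,
  (forall i, (0 < i < d)%N -> z *m T i = q *: z) -> (z <= (const_mx 1 : 'rV_m))%MS.
Hypothesis T_fixed_U : forall z : 'rV_m,
  (forall i, (1 < i < d)%N -> z *m T i = q *: z) -> (z <= U)%MS.
Hypothesis U_stable : forall i, (0 < i < d)%N -> stablemx U (T i).
Hypothesis rho_gt0 : 0 < rho.
Hypothesis rhoE : rho ^+ 2 = q ^+ (d * d.-2).

Local Notation one := (const_mx 1 : 'rV[R]_m).

(** Moving T_i past [A d] twice replaces i by d - i and then by i again. *)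
Lemma comm_T_full_twist i : (0 < i < d)%N -> comm_mx (A d *m A d) (T i).
Proof.
move=> id; have id' : (0 < d - i < d)%N by lia.
rewrite /comm_mx mulmxA T_comm_A // -[RHS]mulmxA T_comm_A // subKn; last by lia.
by rewrite mulmxA.
Qed.

Lemma eigenspace_full_twist_stable k (W : 'M[R]_(k, m)) mu :
  (forall i, (0 < i < d)%N -> stablemx W (T i)) ->
  forall i, (0 < i < d)%N ->
  stablemx (eigenspace (A d *m A d) mu :&: kermx W^T)%MS (T i).
Proof.
move=> WT i id; rewrite sub_capmx.
rewrite (submx_trans (submxMr _ (capmxSl _ _))) /=; last first.
  exact: comm_mx_stable_eigenspace (comm_T_full_twist id).
apply: submx_trans (submxMr _ (capmxSr _ _)) _.
by apply: stablemx_orth; [exact: T_sym | exact: WT].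
Qed.

Lemma full_twist_cap k (W : 'M[R]_(k, m)) mu :
  (eigenspace (A d *m A d) mu :&: kermx W^T)%MS *m (A d *m A d) =
  mu *: (eigenspace (A d *m A d) mu :&: kermx W^T)%MS.
Proof. by apply/eigenspaceP; apply: capmxSl. Qed.

(** The constant vector has an eigenvalue c >= 0. An eigenvector not orthogonal to it has l = c,
    because [A d] is symmetric; any other lies in an l^2-eigenspace of the square orthogonal to the
    constants, where l^2 <= rho^2. *)
Lemma eigenvalue_A_ge l : eigenvalue (A d) l -> - rho <= l.
Proof.
case/eigenvalueP=> e eA e0.
have [c c0 oneA] : exists2 c, 0 <= c & one *m A d = c *: one.
  apply: (A_closed (P := fun X => exists2 c, 0 <= c & one *m X = c *: one)).
  - by exists 1; rewrite // mulmx1 scale1r.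
  - move=> i X id [c c0 cX]; exists (q * c); first by rewrite mulr_ge0 // ltW // (lt_trans _ q_gt1).
    by rewrite mulmxA const_T // -scalemxAl cX scalerA.
  - by rewrite d_gt0 /=.
have [e1|e1] := eqVneq (e *m one^T) 0; last first.
  have : l *: (e *m one^T) = c *: (e *m one^T).
    rewrite scalemxAl -eA -mulmxA -[A d]A_sym -trmx_mul oneA.
    by rewrite linearZ /= scalemxAr.
  move/(congr1 (fun X : 'M_1 => X 0 0)); rewrite !mxE => /mulIf ->.
    by rewrite (le_trans _ c0) // oppr_le0 ltW.
  apply: contraNneq e1 => e1; apply/eqP/matrixP => i j.
  by rewrite !ord1 !mxE.
pose K := (eigenspace (A d *m A d) (l ^+ 2) :&: kermx one^T)%MS.
have eK : (e <= K)%MS.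
  rewrite sub_capmx; apply/andP; split; last exact/sub_kermxP.
  by apply/eigenspaceP; rewrite mulmxA eA -scalemxAl eA scalerA expr2.
have K0 : K != 0.
  by apply: contraNneq e0 => K0; move: eK; rewrite K0 submx0.
have oneT i : (0 < i < d)%N -> stablemx one (T i).
  by move=> id; rewrite const_T // scalemx_sub.
have := full_twist_eigenvalue_le
  (eigenspace_full_twist_stable (l ^+ 2) oneT)
  (sqr_ge0 l) d_gt0 (full_twist_cap one (l ^+ 2)) _ K0.
rewrite -rhoE => lrho; rewrite lerNl leNgt; apply/negP => rhol.
suff : rho ^+ 2 < l ^+ 2.
  rewrite ltNge lrho // => z; rewrite sub_capmx => /andP[_ /sub_kermxP z1].
  move=> /T_fixed_const /sub_rVP[a za]; apply: row_norm_eq0.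
  by rewrite {2}za linearZ /= -scalemxAr z1 scaler0.
rewrite -[l ^+ 2]sqrrN ltr_pXn2r ?nnegrE // ltW // (lt_trans rho_gt0) //.
Qed.

(** By the strict bound, Y = A^2 - rho^2 is injective on the orthogonal complement W of U, hence
    maps W onto itself. So v is in the image of the symmetric matrix Y, whereas e Y = 0. *)
Lemma eigenspace_A_orth (v e : 'rV[R]_m) :
  v *m U^T = 0 -> e *m A d = - rho *: e -> e *m v^T = 0.
Proof.
move=> vU eA; set W := kermx U^T; set Y := A d *m A d - (rho ^+ 2)%:M.
have Ysym : Y^T = Y by rewrite /Y linearB /= trmx_mul A_sym tr_scalar_mx.
have eY : e *m Y = 0.
  by rewrite mulmxBr mulmxA eA -scalemxAl eA scalerA mulrNN -expr2 mul_mx_scalar subrr.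
have WY0 : (eigenspace (A d *m A d) (rho ^+ 2) :&: W)%MS = 0.
  apply/eqP; apply: contraT => K0.
  have := full_twist_eigenvalue_lt
    (eigenspace_full_twist_stable (rho ^+ 2) U_stable)
    (sqr_ge0 rho) d_gt0 (full_twist_cap U (rho ^+ 2)) _ K0.
  rewrite -rhoE ltxx => -> // z; rewrite sub_capmx => /andP[_ /sub_kermxP zU].
  move=> /T_fixed_U /submxP[D zD]; apply: row_norm_eq0.
  by rewrite [in z^T]zD trmx_mul mulmxA zU mul0mx.
have WA : stablemx W (A d).
  apply: (A_closed (P := fun X => stablemx W X)); last by rewrite d_gt0 /=.
    exact: stablemxC.
  move=> i X id; apply: stablemxM; apply: stablemx_orth (U_stable id).
  exact: T_sym.
have WY : stablemx W Y by rewrite stablemxD ?stablemxM // stablemxN stablemxC.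
have : (W <= W *m Y)%MS.
  have [_ <-] := mxrank_leqif_sup WY.
  have WK0 : (W :&: kermx Y)%MS = 0 by rewrite capmxC.
  by rewrite -[X in _ == X](mxrank_mul_ker W Y) WK0 mxrank0 addn0.
have /submx_trans vW : (v <= W)%MS by apply/sub_kermxP.
move=> /vW /submxP[D ->].
by rewrite !trmx_mul Ysym !mulmxA eY !mul0mx.
Qed.

End HeckeRestriction.

(** * Chambers and galleries *)

Lemma sum_natr_bool (R : pzSemiRingType) (T : finType) (P : pred T) :
  \sum_C (P C)%:R = #|P|%:R :> R.
Proof. by rewrite -natr_sum -sum1_card [in RHS]big_mkcond. Qed.

Lemma card_mem_vspace (F : finFieldType) (d : nat) (V : {vspace 'rV[F]_d}) :
  #|[pred u | u \in V]| = (#|F| ^ \dim V)%N.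
Proof. by rewrite -card_vspace; apply: eq_card. Qed.

Section ChamberSteps.
Variables (F : finFieldType) (d : nat).
Hypothesis d_gt0 : (0 < d)%N.
Local Notation vsp := {vspace 'rV[F]_d}.
Local Notation chamber := (chamber F d).
Implicit Types (C D E : chamber) (V W : vsp) (i j k : nat).

(* C_j, extended by C_0 = 0 and C_j = F^d for j >= d. *)
Definition step C j : vsp :=
  if j is j'.+1 then if insub j' is Some i then C i else fullv else 0%VS.

Lemma step0 C : step C 0 = 0%VS. Proof. by []. Qed.

Lemma stepS C (i : 'I_d.-1) : step C i.+1 = C i.
Proof. by rewrite /step valK. Qed.

Lemma step_full C j : (d <= j)%N -> step C j = fullv.
Proof. by case: j => [|j] dj; rewrite /step ?insubF //; lia. Qed.

Arguments step : simpl never.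

Lemma stepP C j :
  [\/ j = 0%N, exists i : 'I_d.-1, j = i.+1 | (d <= j)%N].
Proof.
case: j => [|j]; first by constructor 1.
have [dj|jd] := leqP d j.+1; first by constructor 3.
have jd' : (j < d.-1)%N by lia.
by constructor 2; exists (Ordinal jd').
Qed.

Lemma dim_rVfull : \dim {:'rV[F]_d} = d.
Proof. by rewrite dimvf /dim /= mul1n. Qed.

Lemma dim_step C j : (j <= d)%N -> \dim (step C j) = j.
Proof.
case: (stepP C j) => [->|[i ->]|dj] jd; first by rewrite dimv0.
  by rewrite stepS; have /andP[/forallP/(_ i)/eqP-> _] := chamberP C.
by rewrite step_full // dim_rVfull; apply/eqP; rewrite eqn_leq dj.
Qed.

Lemma step_le C i j : (i <= j)%N -> (step C i <= step C j)%VS.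
Proof.
move=> ij; case: (stepP C j) => [j0|[j' jj]|dj].
- by move: ij; rewrite j0 leqn0 => /eqP ->.
- case: (stepP C i) => [->|[i' ii]|di]; first by rewrite sub0v.
    rewrite jj ii !stepS; have /andP[_ /forallP/(_ i')/forallP/(_ j')] := chamberP C.
    by move=> /implyP; apply; lia.
  by have := ltn_ord j'; lia.
- by rewrite (step_full C dj) subvf.
Qed.

Lemma chamber_eq C D :
  (forall j, (0 < j < d)%N -> step C j = step D j) -> C = D.
Proof.
move=> CD; apply: val_inj; apply/ffunP => i /=.
by rewrite -[LHS]stepS -[RHS]stepS CD //; have := ltn_ord i; lia.
Qed.

Lemma chamber_of_steps (g : nat -> vsp) :
  (forall j, (0 < j < d)%N -> \dim (g j) = j) ->
  (forall j, (0 < j)%N -> (j.+1 < d)%N -> (g j <= g j.+1)%VS) ->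
  exists C, forall j, (0 < j < d)%N -> step C j = g j.
Proof.
move=> dimg leg; pose c : {ffun 'I_d.-1 -> vsp} := [ffun i : 'I_d.-1 => g i.+1].
have cP : is_chamber c.
  apply/andP; split; first by apply/forallP => i; rewrite ffunE dimg //; have := ltn_ord i; lia.
  apply/forallP => i; apply/forallP => j; apply/implyP; rewrite !ffunE.
  case: i j => [i id] [j jd] /= ij; rewrite -(subnKC ij) in jd *.
  elim: (j - i)%N jd => [|k IHk] jd; first by rewrite addn0.
  rewrite addnS; apply: subv_trans (leg _ _ _) => //; last by lia.
  by apply: IHk; lia.
exists (Chamber cP) => j jd; have jd' : (j.-1 < d.-1)%N by lia.
have -> : j = (Ordinal jd').+1 by rewrite /=; lia.
by rewrite stepS ffunE.
Qed.

Definition panel i : rel chamber :=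
  fun C D => [forall j : 'I_d, (j != i :> nat) ==> (step C j == step D j)].

Lemma panelP i C D :
  reflect (forall j, j != i -> step C j = step D j) (panel i C D).
Proof.
apply: (iffP forallP) => [CD j ji|CD j]; last by apply/implyP => /CD ->.
have [jd|dj] := ltnP j d; last by rewrite !step_full.
by have := CD (Ordinal jd) => /implyP/(_ ji)/eqP.
Qed.

Lemma panel_sym i C D : panel i C D = panel i D C.
Proof. by apply/panelP/panelP => CD j /CD ->. Qed.

Lemma panel_trans i C D E : panel i C D -> panel i C E = panel i D E.
Proof.
by move=> /panelP CD; apply/panelP/panelP => h j ji; rewrite -h // CD.
Qed.

Lemma panel_eq i C D : panel i C D -> step C i = step D i -> C = D.
Proof.
by move=> /panelP CD ei; apply: chamber_eq => j _; have [->|/CD] := eqVneq j i.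
Qed.

Lemma panel_exists i C W : (0 < i < d)%N -> \dim W = i ->
  (step C i.-1 <= W <= step C i.+1)%VS ->
  exists2 D, panel i C D & step D i = W.
Proof.
move=> id dW /andP[lW Wl].
have [||D DE] := @chamber_of_steps (fun j => if j == i then W else step C j).
- by move=> j jd; case: eqP => [->//|_]; rewrite dim_step //; lia.
- move=> j j0 jd; have [->|ji] := eqVneq j i.
    by rewrite ifF //; apply/eqP; lia.
  have [ji'|_] := eqVneq j.+1 i; last exact: step_le.
  by move: lW; rewrite -ji'.
exists D; last by rewrite DE // eqxx.
apply/panelP => j ji; have [jd|] := boolP (0 < j < d)%N; first by rewrite DE // (negPf ji).
by case: j {ji} => [//|j] jd; rewrite !step_full //; lia.
Qed.

Lemma card_panel_step i C W : (0 < i < d)%N -> \dim W = i ->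
  (step C i.-1 <= W <= step C i.+1)%VS ->
  #|[pred D | panel i C D & step D i == W]| = 1%N.
Proof.
move=> id dW lWl; have [D CD DW] := panel_exists id dW lWl.
rewrite -[RHS](card1 D); apply: eq_card => E; rewrite !inE.
apply/andP/eqP => [[CE /eqP EW]|->]; last by rewrite CD DW.
by apply: (@panel_eq i); rewrite ?DW // -(panel_trans _ CE) // CD.
Qed.

Lemma panel_off i j C D : panel i C D -> j != i -> step C j = step D j.
Proof. by move=> /panelP; apply. Qed.

(** The i-th member is forced to be C_(i-1) + <u>. *)
Lemma card_panel_mem i C (u : 'rV[F]_d) : (0 < i < d)%N ->
  u \notin step C i.-1 -> u \in step C i.+1 ->
  #|[pred D | panel i C D & u \in step D i]| = 1%N.
Proof.
move=> id uN uS; set W := (step C i.-1 + <[u]>)%VS.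
have u0 : u != 0 by apply: contraNneq uN => ->; rewrite mem0v.
have dW : \dim W = i.
  rewrite dimv_disjoint_sum ?dim_step ?dim_vline ?u0 /=; try lia.
  apply/eqP; rewrite -subv0; apply/subvP => x; rewrite memv_cap memv0.
  case/andP => xC /vlineP[a xa]; apply: contraNT uN; rewrite xa scaler_eq0.
  rewrite (negPf u0) orbF => a0.
  by rewrite -[u](scalerK a0) memvZ // -xa.
have lWl : (step C i.-1 <= W <= step C i.+1)%VS.
  rewrite addvSl subv_add -memvE uS andbT; apply: step_le; lia.
transitivity #|[pred D | panel i C D & step D i == W]|; last exact: card_panel_step.
apply: eq_card => D; rewrite !inE.
apply: andb_id2l => CD; rewrite eq_sym eqEdim dW dim_step ?leqnn ?andbT; last by lia.
rewrite subv_add -memvE (panel_off CD) ?step_le //; lia.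
Qed.

(* Each vector of C_{i+1} outside C_{i-1} lies in the i-th member of exactly one
   chamber of the panel. *)
Lemma card_panel i C : (0 < i < d)%N -> #|[pred D | panel i C D]| = #|F|.+1.
Proof.
move=> id; pose dif (U V : {vspace 'rV[F]_d}) := [pred u | (u \in V) && (u \notin U)].
have card_dif U V : (U <= V)%VS -> #|dif U V| = (#|F| ^ \dim V - #|F| ^ \dim U)%N.
  move=> UV; rewrite -!card_mem_vspace -[#|[pred u | u \in V]|](cardID [pred u | u \in U]).
  have -> : #|[predI [pred u | u \in V] & [pred u | u \in U]]| = #|[pred u | u \in U]|.
    by apply: eq_card => u; rewrite !inE andbC; case: (boolP (u \in U)) => // /(subvP UV) ->.
  by rewrite addKn; apply: eq_card => u; rewrite !inE andbC.
have lo : (step C i.-1 <= step C i.+1)%VS by apply: step_le; lia.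
have : (\sum_(u in dif (step C i.-1) (step C i.+1)) #|[pred D | panel i C D & u \in step D i]|)%N
     = (\sum_(D | panel i C D) #|dif (step D i.-1) (step D i)|)%N.
  under eq_bigr => u do rewrite -sum1_card.
  under [RHS]eq_bigr => D do rewrite -sum1_card.
  rewrite (exchange_big_dep (fun D => panel i C D)) /=; last first.
    by move=> u D _; rewrite inE => /andP[].
  apply: eq_bigr => D CD; apply: eq_bigl => u; rewrite !inE CD /=.
  have [nl nu] : i.-1 != i /\ i.+1 != i by split; lia.
  rewrite (panel_off CD nl) (panel_off CD nu) andbC andbA; congr (_ && _).
  by apply: andb_idr; apply: subvP; apply: step_le.
rewrite (eq_bigr (fun=> 1%N)); last first.
  by move=> u /andP[uS uN]; apply: card_panel_mem.
rewrite sum1_card card_dif // !dim_step //; try lia.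
rewrite (eq_bigr (fun=> #|F| ^ i - #|F| ^ i.-1)%N); last first.
  by move=> D CD; rewrite card_dif ?step_le ?dim_step //; lia.
rewrite sum_nat_const; have [i' ii] : exists i', i = i'.+1 by exists i.-1; lia.
rewrite ii /= !expnS; have F1 := finNzRing_gt1 F.
have P0 : (0 < #|F| ^ i')%N by rewrite expn_gt0 (ltn_trans _ F1).
set f := #|F| in F1 P0 *; set P := (f ^ i')%N in P0 *; set N := #|_| => e.
(* The double count reads q^(i+1) - q^(i-1) = N (q^i - q^(i-1)); a factor q^(i-1) (q - 1) is exposed
   on both sides to be cancelled. *)
have {e} : (P * (f - 1) * f.+1 = P * (f - 1) * N)%N.
  transitivity (f * (f * P) - P)%N; first by nia.
  rewrite e; nia.
by move/eqP; rewrite eqn_pmul2l => [/eqP//|]; rewrite muln_gt0 P0 subn_gt0.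
Qed.

(** * Hecke operators and opposition as matrices *)

Variable R : rcfType.
Local Notation m := #|{: chamber}|.
Local Notation M r := (adjacency_mx R (r : rel chamber)).
Local Notation q := (#|F|%:R : R).

Lemma sum_chamber (g : chamber -> R) : \sum_(a < m) g (enum_val a) = \sum_C g C.
Proof.
rewrite (reindex _ (onW_bij _ (@enum_rank_bij chamber))).
by apply: eq_bigr => C _; rewrite enum_rankK.
Qed.

Lemma mul_adjacency_mx (r s : rel chamber) :
  M r *m M s = \matrix_(a, b)
    #|[pred D | r (enum_val a) D & s D (enum_val b)]|%:R.
Proof.
apply/matrixP => a b; rewrite !mxE -sum_natr_bool -sum_chamber.
by apply: eq_bigr => c _; rewrite !mxE -natrM mulnb.
Qed.

(** [panel i] is an equivalence relation; removing the identity leaves the pairs that really differ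
    in the i-th member. *)
Definition hecke i : 'M[R]_m := M (panel i) - 1%:M.

Lemma adjacency_mx_sym (r : rel chamber) :
  (forall C D, r C D = r D C) -> (M r)^T = M r.
Proof. by move=> rs; apply/matrixP => a b; rewrite !mxE rs. Qed.

Lemma hecke_sym i : (hecke i)^T = hecke i.
Proof.
rewrite /hecke linearB /= tr_scalar_mx adjacency_mx_sym //.
exact: panel_sym.
Qed.

Lemma hecke_quadratic i : (0 < i < d)%N ->
  (hecke i - q%:M) *m (hecke i + 1%:M) = 0.
Proof.
move=> id; rewrite /hecke subrK -addrA -opprD -raddfD /= mulmxBl mul_scalar_mx.
apply/eqP; rewrite subr_eq0; apply/eqP/matrixP => a b.
rewrite mul_adjacency_mx !mxE; set C := enum_val a; set E := enum_val b.
have [CE|CE] := boolP (panel i C E); last first.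
  rewrite mulr0 (@eq_card0 _ [pred D | _ & _]) // => D; rewrite !inE.
  by apply: contraNF CE => /andP[CD DE]; rewrite (panel_trans E CD).
rewrite mulr1 nat1r -(card_panel C id); congr (_%:R); apply: eq_card => D.
by rewrite !inE [panel i D _]panel_sym -(panel_trans D CE) andbb.
Qed.

(** Relations given by a separate condition on each member of C, so that passing from C to a panel
    neighbour affects a single condition. *)
Definition stepwise (c : chamber -> nat -> pred {vspace 'rV[F]_d}) : rel chamber :=
  fun C D => [forall j : 'I_d.+1, c D j (step C j)].

Implicit Types c : chamber -> nat -> pred {vspace 'rV[F]_d}.

Lemma stepwiseP c C D :
  reflect (forall j, (j <= d)%N -> c D j (step C j)) (stepwise c C D).
Proof.
apply: (iffP forallP) => [CD j jd|CD j]; last by apply: CD; rewrite -ltnS.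
by have := CD (Ordinal (jd : j < d.+1)%N).
Qed.

(* If the other conditions single out one possible member W of the panel, then
   T_i exchanges "C_i = W" and "C_i <> W". *)
Lemma hecke_stepwise i c c' (W : chamber -> chamber -> {vspace 'rV[F]_d}) :
  (0 < i < d)%N ->
  (forall D j V, j != i -> c D j V = c' D j V) ->
  (forall C C' D, panel i C C' -> W C D = W C' D) ->
  (forall C D, (forall j, (j <= d)%N -> j != i -> c D j (step C j)) ->
     [/\ \dim (W C D) = i, (step C i.-1 <= W C D <= step C i.+1)%VS,
         c D i (step C i) = (step C i == W C D) &
         c' D i (step C i) = (step C i != W C D)]) ->
  hecke i *m M (stepwise c) = M (stepwise c').
Proof.
move=> id cc' WP cW.
apply/eqP; rewrite /hecke mulmxBl mul1mx subr_eq addrC; apply/eqP/matrixP => a b.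
rewrite mul_adjacency_mx !mxE; set C := enum_val a; set D := enum_val b.
(* The conditions away from index i, which are constant on each i-panel. *)
pose H C := [forall j : 'I_d.+1, (j != i :> nat) ==> c D j (step C j)].
have HP C' : reflect (forall j, (j <= d)%N -> j != i -> c D j (step C' j)) (H C').
  apply: (iffP forallP) => [CD j jd ji|CD j].
    by have := CD (Ordinal (jd : j < d.+1)%N); rewrite ji.
  by apply/implyP; apply: CD; rewrite -ltnS.
have HW C' : H C' -> stepwise c C' D = (step C' i == W C' D) /\
                    stepwise c' C' D = (step C' i != W C' D).
  move/HP => HC'; have [_ _ <- <-] := cW _ _ HC'; split.
    apply/stepwiseP/idP => [|ci j jd]; first by apply; lia.
    by have [->|ji] := eqVneq j i; last exact: HC'.
  apply/stepwiseP/idP => [|ci j jd]; first by apply; lia.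
  by have [->//|ji] := eqVneq j i; rewrite -cc' //; apply: HC'.
have NH C' : ~~ H C' -> stepwise c C' D = false /\ stepwise c' C' D = false.
  move=> HC'; split; apply: contraNF HC' => /stepwiseP s; apply/HP => j jd ji.
    exact: s.
  by rewrite cc' ?s.
have HC C' : panel i C C' -> H C' = H C.
  by move=> CC'; apply/HP/HP => s j jd ji; have := s j jd ji; rewrite (panel_off CC').
have [Ht|Hf] := boolP (H C); last first.
  have [-> ->] := NH _ Hf; rewrite addr0 (@eq_card0 _ [pred D | _ & _]) //.
  move=> E; rewrite !inE; apply/negP => /andP[CE].
  by have [|-> //] := NH E; rewrite HC.
have [dW lW _ _] := cW _ _ (HP _ Ht); have [-> ->] := HW _ Ht.
rewrite (@eq_card _ _ [pred E | panel i C E & step E i == W C D]); last first.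
  move=> E; rewrite !inE; apply: andb_id2l => CE.
  by have [|-> _] := HW E; rewrite ?HC // (WP _ _ _ CE).
by rewrite card_panel_step // -natrD; case: eqP.
Qed.

(* With w_k the longest word in s_1, .., s_(k-1), oppmx k, gallerymx k l and
   near_oppmx k i are the matrices T_w for w = w_k, s_l s_(l+1) .. s_k w_k and
   s_i w_k respectively. *)
Definition opp_cond k D j V : bool :=
  if (k <= j)%N then V == step D j else (V :&: step D (k - j) == 0)%VS.

(** Members of index l, .., k are already in general position to D inside D_(k+1), while those below
    l still lie in D_k and are in general position there. *)
Definition gallery_cond k l D j V : bool :=
  if (k < j)%N then V == step D j
  else if (j < l)%N then (V <= step D k)%VS && (V :&: step D (k - j) == 0)%VS
  else (V :&: step D (k.+1 - j) == 0)%VS.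

Definition near_opp_cond k i D j V : bool :=
  if j == i then (V :&: step D (k - i) != 0)%VS else opp_cond k D j V.

Definition oppmx k : 'M[R]_m := M (stepwise (opp_cond k)).
Definition gallerymx k l : 'M[R]_m := M (stepwise (gallery_cond k l)).
Definition near_oppmx k i : 'M[R]_m := M (stepwise (near_opp_cond k i)).

Lemma dim_cap_ge (U V S : {vspace 'rV[F]_d}) : (U <= S)%VS -> (V <= S)%VS ->
  (\dim U + \dim V <= \dim (U :&: V) + \dim S)%N.
Proof.
by move=> US VS; rewrite -dimv_sum_cap addnC leq_add2l dimvS // subv_add US.
Qed.

Lemma cap_step0 V D : (V :&: step D 0 = 0)%VS.
Proof. by rewrite step0 capv0. Qed.

(** The distinguished member is W = C_(j+1) :&: D_k, the only one of the panel contained in D_k;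
    every other choice of C_j is transversal to D_(k+1-j). *)
Lemma hecke_gallerymx k j : (0 < j <= k)%N -> (k < d)%N ->
  hecke j *m gallerymx k j.+1 = gallerymx k j.
Proof.
move=> jk kd.
apply: (@hecke_stepwise _ _ _ (fun C D => step C j.+1 :&: step D k)%VS); first by lia.
- move=> D i V ij; rewrite /gallery_cond [(i < j.+1)%N]ltnS.
  by rewrite [(i <= j)%N]leq_eqVlt (negPf ij).
- by move=> C C' D CC'; rewrite (panel_off CC') //; lia.
move=> C D CD; set W := (_ :&: _)%VS.
have dC i : (i <= k.+1)%N -> \dim (step C i) = i by move=> ik; apply: dim_step; lia.
have dD i : (i <= k.+1)%N -> \dim (step D i) = i by move=> ik; apply: dim_step; lia.
have Ck : step C k.+1 = step D k.+1.
  by have /(_ kd) := CD k.+1; rewrite /gallery_cond ltnSn => /(_ _)/eqP; apply; lia.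
have CSD : (step C j.+1 <= step D k.+1)%VS by rewrite -Ck step_le; lia.
have capS : (step C j.+1 :&: step D (k - j) = 0)%VS.
  have [->|ltjk] := eqVneq j k; first by rewrite subnn cap_step0.
  have := CD j.+1; rewrite /gallery_cond ltnn subSS ifF; last by lia.
  by move=> /(_ _ _)/eqP; apply; lia.
have CSN : ~~ (step C j.+1 <= step D k)%VS.
  apply/negP => CSk; have [ejk|ltjk] := eqVneq j k.
    by have := dimvS CSk; rewrite ejk dC ?dD; lia.
  have := dim_cap_ge CSk (step_le D (leq_subr j k)).
  by rewrite capS dimv0 dC ?dD; lia.
have [Cl capl] : (step C j.-1 <= step D k)%VS /\ (step C j.-1 :&: step D (k.+1 - j) = 0)%VS.
  have := CD j.-1; rewrite /gallery_cond ifF ?ifT; try lia.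
  have -> : (k - j.-1 = k.+1 - j)%N by lia.
  by move=> /(_ _ _)/andP[||-> /eqP ->] //; lia.
have Wj : \dim W = j.
  have lej : (\dim W < j.+1)%N.
    rewrite -[X in (_ < X)%N](dC j.+1); last by lia.
    by rewrite ltn_neqAle dimvS ?capvSl // andbT dimv_leqif_eq ?capvSl // -/W; apply: contraNneq CSN => <-; apply: capvSr.
  have := dim_cap_ge CSD (step_le D (leqnSn k)); rewrite -/W dC ?dD; lia.
have WS : (W <= step C j.+1)%VS by apply: capvSl.
have Wk : (W <= step D k)%VS by apply: capvSr.
have lW : (step C j.-1 <= W)%VS by rewrite subv_cap Cl step_le; lia.
split; rewrite ?lW //.
- rewrite /gallery_cond ifF ?ltnSn; last by lia.
  apply/andP/eqP => [[Cjk _]|CW].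
    apply/eqP; rewrite eqEdim Wj dC; last by lia.
    by rewrite leqnn andbT subv_cap Cjk step_le; lia.
  rewrite CW Wk; split=> //; rewrite -subv0 -capS; apply: capvS => //.
- rewrite /gallery_cond ifF ?ltnn; last by lia.
  have capD : (step C j.+1 :&: step D (k.+1 - j) <= W)%VS.
    by rewrite capvS // step_le; lia.
  apply/eqP/idP => [cap0|CW].
    (* If C_j = W, then C_(j+1) meets D_(k+1-j) inside C_j, so trivially; but inside D_(k+1) their
       dimensions add up to k + 2. *)
    apply/eqP => CW.
    have : (step C j.+1 :&: step D (k.+1 - j) <= step C j :&: step D (k.+1 - j))%VS.
      by rewrite subv_cap CW capD capvSr.
    rewrite cap0 subv0 => /eqP cap1.
    have := dim_cap_ge CSD (step_le D (leq_subr j k.+1)).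
    by rewrite cap1 dimv0 dC ?dD; lia.
  apply/eqP; rewrite -subv0 -capl subv_cap capvSr andbT.
  (* Two distinct members of one panel meet exactly in C_(j-1), which is transversal to
     D_(k+1-j). *)
  have -> : step C j.-1 = (step C j :&: W)%VS.
    apply/eqP; rewrite eqEdim subv_cap lW step_le /=; try lia.
    rewrite dC; last by lia.
    have : (\dim (step C j :&: W) < j)%N; last by lia.
    rewrite -[X in (_ < X)%N](dC j); last by lia.
    rewrite ltn_neqAle dimvS ?capvSl // andbT dimv_leqif_eq ?capvSl //.
    apply: contraNneq CW => CW; rewrite eqEdim Wj dC ?leqnn ?andbT; last by lia.
    by rewrite -CW capvSr.
  rewrite subv_cap capvSl (subv_trans _ capD) // capvS // step_le; lia.
Qed.

(** The line L = C_(i+1) :&: D_(k-i) avoids C_(i-1), so W = C_(i-1) + L is the only member of the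
    panel that meets D_(k-i). *)
Lemma hecke_near_oppmx k i : (0 < i < k)%N -> (k <= d)%N ->
  hecke i *m near_oppmx k i = oppmx k.
Proof.
move=> ik kd.
apply: (@hecke_stepwise _ _ _
  (fun C D => step C i.-1 + (step C i.+1 :&: step D (k - i)))%VS); first by lia.
- by move=> D j V ji; rewrite /near_opp_cond (negPf ji).
- by move=> C C' D CC'; rewrite !(panel_off CC') //; lia.
move=> C D CD; set L := (_ :&: _)%VS; set W := (_ + _)%VS.
have {}CD j : (j <= d)%N -> j != i -> opp_cond k D j (step C j).
  by move=> jd ji; have := CD j jd ji; rewrite /near_opp_cond (negPf ji).
have dC j : (j <= k)%N -> \dim (step C j) = j by move=> jk; apply: dim_step; lia.
have dD j : (j <= k)%N -> \dim (step D j) = j by move=> jk; apply: dim_step; lia.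
have Ck : step C k = step D k.
  by have /(_ kd) := CD k; rewrite /opp_cond leqnn => /(_ _)/eqP; apply; lia.
have CSD : (step C i.+1 <= step D k)%VS by rewrite -Ck step_le; lia.
have capS : (step C i.+1 :&: step D (k - i.+1) = 0)%VS.
  have [->|ltik] := eqVneq i.+1 k; first by rewrite subnn cap_step0.
  have := CD i.+1; rewrite /opp_cond ifF; last by lia.
  by move=> /(_ _ _)/eqP; apply; lia.
(* Inside D_k the dimensions i + 1 and k - i force L to be nonzero; as L avoids the hyperplane
   D_(k-i-1) of D_(k-i), it is a line. *)
have L1 : \dim L = 1%N.
  have L_gt0 := dim_cap_ge CSD (step_le D (leq_subr i k)).
  have L_lt2 : (\dim L + \dim (step D (k - i.+1)) <=
      \dim (L :&: step D (k - i.+1)) + \dim (step D (k - i)))%N.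
    by apply: dim_cap_ge; rewrite ?capvSr // step_le; lia.
  have capL : (L :&: step D (k - i.+1) = 0)%VS.
    by apply/eqP; rewrite -subv0 -capS capvS ?capvSl.
  by move: L_gt0 L_lt2; rewrite capL dimv0 -/L !dC ?dD; lia.
have capl : (step C i.-1 :&: L = 0)%VS.
  have : (step C i.-1 :&: step D (k - i.-1) = 0)%VS.
    have := CD i.-1; rewrite /opp_cond ifF; last by lia.
    by move=> /(_ _ _)/eqP; apply; lia.
  move=> capl; apply/eqP; rewrite -subv0 -capl capvS //.
  by apply: subv_trans (capvSr _ _) _; rewrite step_le; lia.
have dW : \dim W = i by rewrite dimv_disjoint_sum // L1 dC; lia.
have lW : (step C i.-1 <= W <= step C i.+1)%VS.
  by rewrite addvSl subv_add capvSl step_le //; lia.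
have near : (step C i :&: step D (k - i) != 0)%VS = (step C i == W).
  apply/idP/eqP => [cap|CW].
    apply/eqP; rewrite eq_sym eqEdim dW dC ?leqnn ?andbT; last by lia.
    rewrite subv_add step_le; last by lia.
    have capL : (step C i :&: step D (k - i) <= L)%VS by rewrite capvS // step_le //; lia.
    have /eqP <- : (step C i :&: step D (k - i))%VS == L; last exact: capvSl.
    by rewrite eqEdim capL L1 lt0n dimv_eq0.
  have : (L <= step C i :&: step D (k - i))%VS by rewrite subv_cap CW addvSr capvSr.
  by move/dimvS; rewrite L1 lt0n dimv_eq0.
split=> //; first by rewrite /near_opp_cond eqxx.
by rewrite -near /opp_cond ifF ?negbK //; lia.
Qed.

Lemma eq_adjacency_mx (r s : rel chamber) : (forall C D, r C D = s C D) -> M r = M s.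
Proof. by move=> rs; apply/matrixP => a b; rewrite !mxE rs. Qed.

Lemma oppmx1 : oppmx 1 = 1%:M.
Proof.
apply/matrixP => a b; rewrite !mxE; congr ((nat_of_bool _)%:R).
apply/stepwiseP/eqP => [CD|-> [|j] _]; last 2 first.
- by rewrite /opp_cond /= cap0v.
- by rewrite /opp_cond /=.
apply: enum_val_inj; apply: chamber_eq => // j /andP[j0 jd]; apply/eqP.
by have := CD j (ltnW jd); rewrite /opp_cond j0.
Qed.

Lemma gallerymx_start k : (0 < k < d)%N -> gallerymx k k.+1 = oppmx k.
Proof.
move=> kd; apply: eq_adjacency_mx => C D; rewrite /opp_cond /gallery_cond.
have Cj j : step C k = step D k -> (j <= k)%N -> (step C j <= step D k)%VS.
  by move=> <-; apply: step_le.
apply/stepwiseP/stepwiseP => CD j jd; have := CD j jd.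
  have [kj|jk] := ltnP k j; first by rewrite ltnW.
  rewrite ltnS jk; have [kj|_] := leqP k j; last by move=> /andP[].
  have -> : j = k by lia.
  by case/andP => Ck _; rewrite eqEdim Ck !dim_step //; lia.
have Ck : step C k = step D k by have := CD k; rewrite leqnn => /(_ _)/eqP; apply; lia.
have [kj|jk] := ltnP k j; first by rewrite (ltnW kj).
rewrite ltnS jk (Cj _ Ck jk) /=; have [kj _|//] := leqP k j.
have -> : j = k by lia.
by rewrite subnn cap_step0.
Qed.

Lemma gallerymx_end k : (0 < k < d)%N -> gallerymx k 1 = oppmx k.+1.
Proof.
move=> kd; apply: eq_adjacency_mx => C D; rewrite /opp_cond /gallery_cond.
have zero j : (j < 1)%N -> (step C j :&: step D (k.+1 - j) == 0)%VS.
  by rewrite ltnS leqn0 => /eqP ->; rewrite step0 cap0v.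
apply/stepwiseP/stepwiseP => CD j jd; have := CD j jd; case: (ltnP k j) => // kj.
  by case: (ltnP j 1) => // j0 _; apply: zero.
case: (ltnP j 1) => // j0 _; have -> : j = 0%N by lia.
by rewrite step0 sub0v cap0v eqxx.
Qed.

Lemma opp_rel_swap k C D : (k <= d)%N ->
  stepwise (opp_cond k) C D -> stepwise (opp_cond k) D C.
Proof.
move=> kd /stepwiseP CD; apply/stepwiseP => j jd; move: (CD j jd).
rewrite /opp_cond; have [kj|jk _] := leqP k j; first by rewrite eq_sym.
have [->|j0] := posnP j; first by rewrite step0 cap0v.
have := CD (k - j)%N; rewrite /opp_cond ifF; last by lia.
by rewrite (subKn (ltnW jk)) capvC; apply; lia.
Qed.

Lemma oppmx_sym k : (k <= d)%N -> (oppmx k)^T = oppmx k.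
Proof.
by move=> kd; apply: adjacency_mx_sym => C D; apply/idP/idP; apply: opp_rel_swap.
Qed.

Lemma near_opp_rel_swap k i C D : (0 < i < k)%N -> (k <= d)%N ->
  stepwise (near_opp_cond k i) C D -> stepwise (near_opp_cond k (k - i)) D C.
Proof.
move=> ik kd /stepwiseP CD; apply/stepwiseP => j jd; rewrite /near_opp_cond.
have [->|ji] := eqVneq j (k - i)%N.
  have := CD i; rewrite /near_opp_cond eqxx subKn; last by lia.
  by rewrite capvC; apply; lia.
rewrite /opp_cond; have [kj|jk] := leqP k j.
  have := CD j jd; rewrite /near_opp_cond ifF; last by lia.
  by rewrite /opp_cond kj eq_sym.
have [->|j0] := posnP j; first by rewrite step0 cap0v.
have := CD (k - j)%N; rewrite /near_opp_cond ifF; last by lia.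
rewrite /opp_cond ifF; last by lia.
by rewrite (subKn (ltnW jk)) capvC; apply; lia.
Qed.

Lemma near_oppmx_tr k i : (0 < i < k)%N -> (k <= d)%N ->
  (near_oppmx k i)^T = near_oppmx k (k - i).
Proof.
move=> ik kd; apply/matrixP => a b; rewrite !mxE; congr ((nat_of_bool _)%:R).
apply/idP/idP => [/near_opp_rel_swap|/near_opp_rel_swap]; first by apply.
by rewrite subKn; [apply; lia | lia].
Qed.

(* Both sides equal T_i Y T_(k-i), where Y is the relation "opposite up to the
   i-th step". *)
Lemma hecke_oppmx_comm k i : (0 < i < k)%N -> (k <= d)%N ->
  hecke i *m oppmx k = oppmx k *m hecke (k - i).
Proof.
move=> ik kd; have ik' : (0 < k - i < k)%N by lia.
have YT : near_oppmx k i *m hecke (k - i) = oppmx k.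
  rewrite -[LHS]trmxK trmx_mul hecke_sym near_oppmx_tr //.
  by rewrite hecke_near_oppmx // oppmx_sym.
by rewrite -{1}YT mulmxA hecke_near_oppmx.
Qed.

Lemma oppmx_opposite : oppmx d = M (@opposite F d).
Proof.
apply: eq_adjacency_mx => C D; apply/stepwiseP/forallP => CD.
  move=> i; have := CD i.+1; have id := ltn_ord i.
  rewrite /opp_cond ifF; last by lia.
  have -> : (d - i.+1 = (rev_ord i).+1)%N by rewrite /=; lia.
  by rewrite !stepS; apply; lia.
move=> j jd; rewrite /opp_cond; have [dj|ltjd] := leqP d j; first by rewrite !step_full.
case: (stepP C j) => [->|[i ji]|dj]; [by rewrite step0 cap0v| |by lia].
have id := ltn_ord i.
have -> : (d - j = (rev_ord i).+1)%N by rewrite ji /=; lia.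
by rewrite ji !stepS.
Qed.

(** * The functions [u \in C_j] and the action of Hecke operators on them *)

Definition flag_col j (u : 'rV[F]_d) : 'cV[R]_m :=
  \col_a (u \in step (enum_val a) j)%:R.

Lemma flag_col_full u : flag_col d u = const_mx 1.
Proof. by apply/colP => a; rewrite !mxE step_full // memvf. Qed.

Lemma flag_col0 u : u != 0 -> flag_col 0 u = 0.
Proof. by move=> u0; apply/colP => a; rewrite !mxE step0 memv0 (negPf u0). Qed.

Lemma panel_flag_col i j u : M (panel i) *m flag_col j u =
  \col_a #|[pred D | panel i (enum_val a) D & u \in step D j]|%:R.
Proof.
apply/colP => a; rewrite !mxE -sum_natr_bool -sum_chamber.
by apply: eq_bigr => c _; rewrite !mxE -natrM mulnb.
Qed.

Lemma hecke_flag_col_off i j u : (0 < i < d)%N -> j != i ->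
  hecke i *m flag_col j u = q *: flag_col j u.
Proof.
move=> id ji; rewrite /hecke mulmxBl mul1mx panel_flag_col.
apply/colP => a; rewrite !mxE.
have -> : #|[pred D | panel i (enum_val a) D & u \in step D j]| =
    (#|F|.+1 * (u \in step (enum_val a) j))%N.
  have [uC|uC] := boolP (u \in _); last first.
    rewrite muln0; apply: eq_card0 => D; rewrite !inE.
    by apply: contraNF uC => /andP[CD]; rewrite (panel_off CD).
  rewrite muln1 -(card_panel (enum_val a) id); apply: eq_card => D; rewrite !inE.
  by apply: andb_idr => CD; rewrite -(panel_off CD).
by rewrite natrM -natr1; ring.
Qed.

(** Among the q + 1 chambers of a panel, u lies in the i-th member of all, one or none according as
    u is in C_(i-1), in C_(i+1) only, or outside C_(i+1). *)
Lemma hecke_flag_col i u : (0 < i < d)%N -> hecke i *m flag_col i u =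
  q *: flag_col i.-1 u + flag_col i.+1 u - flag_col i u.
Proof.
move=> id; rewrite /hecke mulmxBl mul1mx panel_flag_col; congr (_ - _).
apply/colP => a; rewrite !mxE; set C := enum_val a.
have [uC|uC] := boolP (u \in step C i.-1).
  rewrite (subvP (step_le C (_ : i.-1 <= i.+1)%N)) //; last by lia.
  rewrite mulr1 natr1 -(card_panel C id); congr (_%:R); apply: eq_card => D; rewrite !inE.
  apply: andb_idr => CD; apply: (subvP (step_le D (leq_pred i))).
  by rewrite -(panel_off CD) //; lia.
rewrite mulr0 add0r; congr (_%:R).
have [uS|uS] := boolP (u \in step C i.+1); first by rewrite card_panel_mem.
apply: eq_card0 => D; rewrite !inE; apply: contraNF uS => /andP[CD uD].
rewrite (panel_off CD); last by lia.
exact: (subvP (step_le D (leqnSn i))).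
Qed.

Section FlagFamily.
(** The rules obeyed by [u \in C_j] for nonzero u; they are linear, so they can be applied to a
    difference of two such families. *)
Variable x : nat -> 'cV[R]_m.
Hypothesis x0 : x 0 = 0.
Hypothesis hecke_x_off :
  forall i j, (0 < i < d)%N -> j != i -> hecke i *m x j = q *: x j.
Hypothesis hecke_x : forall i, (0 < i < d)%N ->
  hecke i *m x i = q *: x i.-1 + x i.+1 - x i.

Lemma gallerymx_step k j (X : 'cV[R]_m) : (0 < j <= k)%N -> (k < d)%N ->
  gallerymx k j *m X = hecke j *m (gallerymx k j.+1 *m X).
Proof. by move=> jk kd; rewrite mulmxA hecke_gallerymx. Qed.

Lemma oppmx_fixed k (X : 'cV[R]_m) : (0 < k <= d)%N ->
  (forall i, (0 < i < k)%N -> hecke i *m X = q *: X) ->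
  oppmx k *m X = q ^+ 'C(k, 2) *: X.
Proof.
elim: k => // -[|k] IHk kd fX; first by rewrite oppmx1 mul1mx scale1r.
have {}IHk : oppmx k.+1 *m X = q ^+ 'C(k.+1, 2) *: X.
  by apply: IHk => [|i ik]; [lia | apply: fX; lia].
suff gX i : (i <= k.+1)%N ->
    gallerymx k.+1 (k.+2 - i) *m X = q ^+ ('C(k.+1, 2) + i) *: X.
  have := gX k.+1 (leqnn _); rewrite subSnn gallerymx_end; last by lia.
  by rewrite [in 'C(k.+2, 2)]binS bin1.
elim: i => [|i IHi] ik; first by rewrite subn0 gallerymx_start ?addn0 //; lia.
rewrite gallerymx_step; try lia; have -> : (k.+2 - i.+1).+1 = (k.+2 - i)%N by lia.
rewrite IHi; last by lia.
by rewrite -scalemxAr fX ?scalerA ?addnS ?exprSr //; lia.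
Qed.

(** T_k sends x_k - x_(k-1) to x_(k+1) - x_k, and the remaining factors T_(k-1), .., T_1 of A_(k+1)
    each multiply the result by q. *)
Lemma oppmx_x1 k : (0 < k <= d)%N ->
  oppmx k *m x 1 = q ^+ 'C(k.-1, 2) *: (x k - x k.-1).
Proof.
elim: k => // -[|k] IHk kd; first by rewrite oppmx1 mul1mx scale1r x0 subr0.
have {}IHk : oppmx k.+1 *m x 1 = q ^+ 'C(k, 2) *: (x k.+1 - x k) by apply: IHk; lia.
suff gX i : (i <= k)%N -> gallerymx k.+1 (k.+1 - i) *m x 1 =
    q ^+ ('C(k, 2) + i) *: (x k.+2 - x k.+1).
  have := gX k (leqnn _); rewrite subSnn gallerymx_end; last by lia.
  by rewrite /= [in 'C(k.+1, 2)]binS bin1.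
elim: i => [|i IHi] ik.
  rewrite subn0 gallerymx_step ?gallerymx_start; try lia.
  rewrite IHk -scalemxAr mulmxBr hecke_x; last by lia.
  rewrite hecke_x_off; try lia.
  by rewrite addn0 /= -[_ + _ - x k.+1]addrA [q *: _ + _]addrC addrK.
rewrite gallerymx_step; try lia; have -> : (k.+1 - i.+1).+1 = (k.+1 - i)%N by lia.
rewrite IHi; last by lia.
rewrite -scalemxAr mulmxBr !hecke_x_off; try lia.
by rewrite -scalerBr scalerA addnS exprSr.
Qed.

Lemma oppmx_x_last : (1 < d)%N -> oppmx d *m x d.-1 =
  q ^+ ('C(d.-1, 2) + d.-2) *: (x d - x 1).
Proof.
move=> d1.
have xlast : oppmx d.-1 *m x d.-1 = q ^+ 'C(d.-1, 2) *: x d.-1.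
  by apply: oppmx_fixed => [|i ik]; [lia | apply: hecke_x_off; lia].
(* The value after applying T_(d-1), .., T_(d-1-i). Each further factor cancels the middle term and
   lowers the index by one, until x_0 = 0 is reached. *)
suff gX i : (i <= d.-2)%N -> gallerymx d.-1 (d.-1 - i) *m x d.-1 =
    q ^+ 'C(d.-1, 2) *:
      (q ^+ i.+1 *: x (d.-2 - i)%N - q ^+ i *: x (d.-1 - i)%N + q ^+ i *: x d).
  have := gX d.-2 (leqnn _).
  have -> : (d.-1 - d.-2 = 1)%N by lia.
  rewrite gallerymx_end; last by lia.
  rewrite subnn x0 scaler0 sub0r prednK // => ->.
  by rewrite addrC -scalerBr scalerA -exprD.
elim: i => [|i IHi] ik.
  rewrite !subn0 gallerymx_step ?gallerymx_start; try lia.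
  rewrite xlast -scalemxAr hecke_x; last by lia.
  by rewrite expr1 expr0 !scale1r addrAC prednK.
rewrite gallerymx_step; try lia.
have -> : (d.-1 - i.+1).+1 = (d.-1 - i)%N by lia.
rewrite IHi; last by lia.
rewrite -scalemxAr mulmxDr mulmxBr -!scalemxAr.
have -> : (d.-2 - i = d.-1 - i.+1)%N by lia.
rewrite hecke_x; last by lia.
rewrite !hecke_x_off; try lia.
have -> : (d.-1 - i.+1).-1 = (d.-2 - i.+1)%N by lia.
have -> : (d.-1 - i.+1).+1 = (d.-1 - i)%N by lia.
congr (_ *: _); rewrite !scalerA -!exprSr scalerBr scalerDr scalerA -exprSr.
by congr (_ + _); rewrite [X in X - _]addrAC addrK.
Qed.

End FlagFamily.

(** * Vectors fixed by Hecke operators up to the factor q *)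

Lemma hecke_fixed_panel i (z : 'rV[R]_m) C D : (0 < i < d)%N ->
  z *m hecke i = q *: z -> panel i C D -> z 0 (enum_rank C) = z 0 (enum_rank D).
Proof.
(* So (q + 1) z(C) is the sum of z over the panel of C, which is also the panel of D. *)
move=> id zi CD; have : z *m M (panel i) = (q + 1) *: z.
  by rewrite scalerDl scale1r -zi mulmxBr mulmx1 subrK.
move=> /rowP zP; have := zP (enum_rank C); have := zP (enum_rank D).
rewrite !mxE; under eq_bigr => a _ do rewrite mxE enum_rankK.
under [in X in _ -> X = _ -> _]eq_bigr => a _ do rewrite mxE enum_rankK.
have -> : \sum_a z 0 a * (panel i (enum_val a) D)%:R =
          \sum_a z 0 a * (panel i (enum_val a) C)%:R.
  apply: eq_bigr => a _; congr (_ * (nat_of_bool _)%:R).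
  by rewrite panel_sym -(panel_trans _ CD) panel_sym.
move=> -> /mulfI -> //; rewrite natr1 pnatr_eq0 //.
Qed.

(* The chambers with prescribed first t members are connected by galleries. *)
Lemma hecke_fixed_eq t (z : 'rV[R]_m) :
  (forall i, (t < i < d)%N -> z *m hecke i = q *: z) ->
  forall C D, (forall j, (j <= t)%N -> step C j = step D j) ->
  z 0 (enum_rank C) = z 0 (enum_rank D).
Proof.
move=> zT.
(* Outer induction on a bound k for the indices where C and D differ. *)
suff Q k : forall C D, (forall j, (j <= t)%N || (k < j)%N -> step C j = step D j) ->
    z 0 (enum_rank C) = z 0 (enum_rank D).
  move=> C D CD; apply: (Q d) => j; case: (leqP j t) => [/CD //|_ /= dj].
  by rewrite !step_full // ltnW.
elim: k => [|k IHk] C D CD.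
  by congr (z 0 (enum_rank _)); apply: chamber_eq => // j /andP[j0 _]; rewrite CD // j0 orbT.
have [kt|tk] := leqP k.+1 t.
  by apply: IHk => j /orP[jt|kj]; apply: CD; rewrite ?jt //; case: leqP; lia.
have [dk|kd] := leqP d k.+1.
  apply: IHk => j /orP[jt|kj]; first by apply: CD; rewrite jt.
  by rewrite !step_full //; lia.
(* Inner induction: C_(k+1-e) is contained in D_(k+1). At e = k + 1 - t this holds because C_t =
   D_t; at e = 0 it gives C_(k+1) = D_(k+1). *)
suff I e : (e <= k.+1 - t)%N -> forall C,
    (forall j, (j <= t)%N || (k.+1 < j)%N -> step C j = step D j) ->
    (step C (k.+1 - e) <= step D k.+1)%VS ->
    z 0 (enum_rank C) = z 0 (enum_rank D).
  apply: (I _ (leqnn _) C CD); have -> : (k.+1 - (k.+1 - t) = t)%N by lia.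
  by rewrite CD ?leqnn // step_le // ltnW.
elim: e {C CD} => [|e IHe] ek C CD CDk.
  apply: IHk => j /orP[jt|kj]; first by apply: CD; rewrite jt.
  have [->|jk] := eqVneq j k.+1; last by apply: CD; apply/orP; right; lia.
  by apply/eqP; rewrite eqEdim; move: CDk; rewrite subn0 => ->; rewrite !dim_step //; lia.
set l := (k.+1 - e.+1)%N in CDk.
have el : (k.+1 - e = l.+1)%N by rewrite /l; lia.
have [Cl|Cl] := boolP (step C l.+1 <= step D k.+1)%VS.
  by apply: IHe CD _; [lia | rewrite el].
(* Replacing C_(l+1) by this hyperplane of C_(l+2) stays in the panel and brings one more member
   into D_(k+1). *)
pose W := (step C l.+2 :&: step D k.+1)%VS.
have CS : (step C l.+2 <= step D k.+2)%VS.
  by rewrite -[step D _]CD ?ltnSn ?orbT // step_le //; lia.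
have dW : \dim W = l.+1.
  have := dim_cap_ge CS (step_le D (leqnSn k.+1)); rewrite -/W !dim_step; try lia.
  have : (\dim W < l.+2)%N; last by lia.
  rewrite -[X in (_ < X)%N](@dim_step C l.+2); last by lia.
  rewrite ltn_neqAle dimvS ?capvSl // andbT dimv_leqif_eq ?capvSl //.
  apply: contraNneq Cl => CW; apply: subv_trans (step_le C (leqnSn _)) _.
  by rewrite -CW capvSr.
have lW : (step C l <= W <= step C l.+2)%VS.
  by rewrite capvSl andbT subv_cap CDk andbT; apply: step_le; lia.
have ld : (0 < l.+1 < d)%N by lia.
have [C' CC' C'W] := panel_exists ld dW lW.
have -> : z 0 (enum_rank C) = z 0 (enum_rank C').
  by apply: hecke_fixed_panel ld _ CC'; apply: zT; lia.
apply: IHe; [by lia | move=> j jk | by rewrite el C'W capvSr].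
by rewrite -(panel_off CC') ?CD //; lia.
Qed.

(** The indices 0 and d are included so that the neighbours i - 1 and i + 1 in [hecke_flag_col] stay
    in the family. *)
Definition flagspace : 'M[R]_m :=
  (\sum_(p : 'I_d.+1 * 'rV[F]_d | p.2 != 0%R) <<(flag_col p.1 p.2)^T>>)%MS.

Lemma flag_col_sub j (u : 'rV[F]_d) : (j <= d)%N -> u != 0 -> ((flag_col j u)^T <= flagspace)%MS.
Proof.
move=> jd u0; pose p : 'I_d.+1 * 'rV[F]_d := (Ordinal (jd : j < d.+1)%N, u).
by apply: (sumsmx_sup p) => //; rewrite genmxE.
Qed.

Lemma flagspace_stable i : (0 < i < d)%N -> stablemx flagspace (hecke i).
Proof.
move=> id; rewrite sumsmxMr; apply/sumsmx_subP => -[j u] /= u0.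
rewrite (eqmxMr _ (genmxE _)) -[hecke i]hecke_sym -trmx_mul.
have jd : (j <= d)%N by rewrite -ltnS.
have [->|ji] := eqVneq (j : nat) i; last first.
  by rewrite hecke_flag_col_off // linearZ scalemx_sub // flag_col_sub.
rewrite hecke_flag_col // linearB linearD /= linearZ /=.
by rewrite addmx_sub ?eqmx_opp ?addmx_sub ?scalemx_sub ?flag_col_sub //; lia.
Qed.

Lemma flagspace_orth (v : 'rV[R]_m) :
  (forall j u, (j <= d)%N -> u != 0 -> v *m flag_col j u = 0) ->
  v *m flagspace^T = 0.
Proof.
move=> v0; rewrite -[v]trmxK -trmx_mul; apply/eqP; rewrite trmx_eq0; apply/eqP.
apply/sub_kermxP/sumsmx_subP => -[j u] /= u0; rewrite genmxE; apply/sub_kermxP.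
by rewrite -trmx_mul v0 ?trmx0 // -ltnS.
Qed.

Lemma hecke_fixed_const (z : 'rV[R]_m) :
  (forall i, (0 < i < d)%N -> z *m hecke i = q *: z) ->
  (z <= (const_mx 1 : 'rV[R]_m))%MS.
Proof.
move=> zT; apply/sub_rVP; have [C|no] := pickP (fun _ : chamber => true); last first.
  by exists 0; apply/rowP => a; have := no (enum_val a).
exists (z 0 (enum_rank C)); apply/rowP => a; rewrite !mxE mulr1 -[a in LHS]enum_valK.
apply: (hecke_fixed_eq zT) => j; rewrite leqn0 => /eqP ->.
by rewrite !step0.
Qed.

Lemma hecke_fixed_flagspace (z : 'rV[R]_m) :
  (forall i, (1 < i < d)%N -> z *m hecke i = q *: z) -> (z <= flagspace)%MS.
Proof.
move=> zT; have q1 : q - 1 != 0.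
  by rewrite subr_eq0 (eqr_nat _ _ 1) gtn_eqF // finNzRing_gt1.
(* Dividing by q - 1 compensates for the q - 1 nonzero vectors of C_1. The default 0 occurs only for
   u in no C_1, where the indicator vanishes. *)
pose a (u : 'rV[F]_d) : R :=
  if [pick C : chamber | u \in step C 1] is Some C
  then z 0 (enum_rank C) / (q - 1) else 0.
have -> : z = \sum_(u : 'rV[F]_d | u != 0) a u *: (flag_col 1 u)^T.
  apply/rowP => b; rewrite summxE -[b in LHS]enum_valK; set C := enum_val b.
  transitivity (\sum_(u | (u != 0) && (u \in step C 1)) z 0 (enum_rank C) / (q - 1)).
    have card1 : (#|[pred u : 'rV[F]_d | (u != 0%R) && (u \in step C 1)]|).+1 = #|F|.
      have := card_mem_vspace (step C 1); rewrite dim_step // expn1 => <-.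
      by rewrite [in RHS](cardD1 0) inE mem0v.
    set S := [pred u | _] in card1.
    have qS : #|S|%:R = q - 1 by rewrite -card1 -natr1 addrK.
    transitivity (\sum_(u in S) z 0 (enum_rank C) / (q - 1)); last exact: eq_bigl.
    transitivity (z 0 (enum_rank C) / (q - 1) * #|S|%:R); first by rewrite qS divfK.
    by rewrite mulr_natr sumr_const.
  rewrite big_mkcondr; apply: eq_bigr => u u0; rewrite !mxE -/C.
  case: ifP => uC; last by rewrite mulr0.
  rewrite mulr1 /a; case: pickP => [D uD|/(_ C)]; last by rewrite uC.
  congr (_ / _); apply: (hecke_fixed_eq zT) => -[|[|//]] _; first by rewrite !step0.
  have line E : u \in step E 1 -> step E 1 = <[u]>%VS.
    by move=> uE; apply/eqP; rewrite eq_sym eqEdim -memvE uE dim_vline u0 dim_step.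
  by rewrite (line C uC) (line D uD).
by apply: summx_sub => u u0; rewrite scalemx_sub // flag_col_sub.
Qed.

(** * The opposition graph in even dimension *)

Section EvenDimension.
Variable n : nat.
Hypothesis n_gt0 : (0 < n)%N.
Hypothesis dE : d = (2 * n)%N.
Local Notation A := (M (@opposite F d)).
Local Notation rho := (q ^+ (2 * n * n.-1)).

Lemma q_gt1 : 1 < q.
Proof. by rewrite (ltr_nat _ 1) finNzRing_gt1. Qed.

Lemma rho_gt0 : 0 < rho.
Proof. by rewrite exprn_gt0 // (lt_trans _ q_gt1). Qed.

Lemma rhoE : rho ^+ 2 = q ^+ (d * d.-2).
Proof. by rewrite -exprM dE; congr (_ ^+ _); case: n n_gt0 => // k _ /=; nia. Qed.

Lemma const_hecke i : (0 < i < d)%N ->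
  const_mx 1 *m hecke i = q *: const_mx 1 :> 'rV[R]_m.
Proof.
move=> id; rewrite -[hecke i]hecke_sym -[const_mx 1]trmxK -trmx_mul trmx_const.
by rewrite -(flag_col_full 0) hecke_flag_col_off ?linearZ //; lia.
Qed.

Lemma opposite_eigenvalue_ge l : eigenvalue A l -> - rho <= l.
Proof.
rewrite -oppmx_opposite.
apply: (@eigenvalue_A_ge R m d q hecke oppmx gallerymx).
- exact: q_gt1.
- by move=> i _; apply: hecke_sym.
- exact: hecke_quadratic.
- exact: oppmx1.
- exact: gallerymx_start.
- exact: gallerymx_end.
- by move=> k j jk kd; rewrite hecke_gallerymx.
- exact: hecke_oppmx_comm.
- exact: d_gt0.
- exact: oppmx_sym.
- exact: const_hecke.
- exact: hecke_fixed_const.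
- exact: rho_gt0.
- exact: rhoE.
Qed.

Lemma opposite_eigenspace_orth (v e : 'rV[R]_m) :
  (forall j (u : 'rV[F]_d), (j <= d)%N -> u != 0 -> v *m flag_col j u = 0) ->
  e *m A = - rho *: e -> e *m v^T = 0.
Proof.
rewrite -oppmx_opposite => /flagspace_orth.
apply: (@eigenspace_A_orth R m d q hecke oppmx gallerymx).
- exact: q_gt1.
- by move=> i _; apply: hecke_sym.
- exact: hecke_quadratic.
- exact: oppmx1.
- exact: gallerymx_start.
- exact: gallerymx_end.
- by move=> k j jk kd; rewrite hecke_gallerymx.
- exact: hecke_oppmx_comm.
- exact: d_gt0.
- exact: oppmx_sym.
- exact: hecke_fixed_flagspace.
- exact: flagspace_stable.
- exact: rho_gt0.
- exact: rhoE.
Qed.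

(** Opposition swaps x_1 and x_(d-1) up to negative factors whose ratio is q^(d-2) = (q^(n-1))^2;
    this explains the coefficient q^(n-1), and the exponent is 'C(2n-1, 2) + n - 1 = 2n(n-1). *)
Lemma oppmx_flag_family (x : nat -> 'cV[R]_m) : x 0 = 0 -> x d = 0 ->
  (forall i j, (0 < i < d)%N -> j != i -> hecke i *m x j = q *: x j) ->
  (forall i, (0 < i < d)%N -> hecke i *m x i = q *: x i.-1 + x i.+1 - x i) ->
  oppmx d *m (q ^+ n.-1 *: x 1 + x d.-1) = - rho *: (q ^+ n.-1 *: x 1 + x d.-1).
Proof.
move=> x0 xd xoff xon; have [d1 dd] : (1 < d)%N /\ (0 < d <= d)%N by split; lia.
rewrite mulmxDr -scalemxAr (oppmx_x1 x0 xoff xon dd) (oppmx_x_last x0 xoff xon d1) xd.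
have c1 : ('C(d.-1, 2) + n.-1 = 2 * n * n.-1)%N.
  rewrite dE; case: n n_gt0 => // k _.
  rewrite (_ : (2 * k.+1).-1 = (k.*2).+1) ?bin2; last by lia.
  by rewrite /= (_ : (k.*2.+1 * k.*2 = ((k.*2).+1 * k).*2)%N) ?doubleK; nia.
have c2 : ('C(d.-1, 2) + d.-2 = 2 * n * n.-1 + n.-1)%N by lia.
rewrite !sub0r c2 !scalerN scaleNr scalerDr !scalerA -!exprD [(n.-1 + _)%N]addnC c1.
by rewrite opprD addrC.
Qed.

Lemma opposite_eigenvalue (C : chamber) : eigenvalue A (- rho).
Proof.
have [u uC u0] : exists2 u, u \in step C 1 & u != 0.
  exists (vpick (step C 1)); first exact: memv_pick.
  by rewrite vpick0 -dimv_eq0 dim_step.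
have [w wC] : exists w, w \notin step C d.-1.
  have : ~~ (fullv <= step C d.-1)%VS.
    apply/negP => /dimvS; rewrite dim_rVfull dim_step; lia.
  by move/subvPn => [w _ wC]; exists w.
have w0 : w != 0 by apply: contraNneq wC => ->; rewrite mem0v.
(* The difference makes x_d vanish. Since u is in C_1 and w is outside C_(d-1), the eigenvector has
   entry q^(n-1) + 1 > 0 at C. *)
pose x j : 'cV[R]_m := flag_col j u - flag_col j w.
have x0 : x 0 = 0 by rewrite /x !flag_col0 ?subrr.
have xd : x d = 0 by rewrite /x !flag_col_full subrr.
have xoff i j : (0 < i < d)%N -> j != i -> hecke i *m x j = q *: x j.
  by move=> id ji; rewrite mulmxBr !hecke_flag_col_off // scalerBr.
have xon i : (0 < i < d)%N -> hecke i *m x i = q *: x i.-1 + x i.+1 - x i.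
  move=> id; rewrite mulmxBr !hecke_flag_col // /x scalerBr.
  by rewrite !opprD !opprK addrACA; congr (_ + _); rewrite addrACA.
pose e := q ^+ n.-1 *: x 1 + x d.-1.
apply/eigenvalueP; exists e^T.
  have Asym : A^T = A by rewrite -oppmx_opposite oppmx_sym.
  rewrite -{1}Asym -trmx_mul -oppmx_opposite.
  by rewrite (oppmx_flag_family x0 xd xoff xon) linearZ.
apply/eqP => /rowP/(_ (enum_rank C)); rewrite !mxE !enum_rankK.
rewrite uC; have -> : u \in step C d.-1 by apply: (subvP (step_le C _)) uC; lia.
have -> : w \in step C 1 = false.
  by apply: contraNF wC; apply: subvP; apply: step_le; lia.
rewrite (negPf wC) !subr0 mulr1 => /eqP; rewrite gt_eqF //.
by rewrite addr_gt0 // exprn_gt0 // (lt_trans _ q_gt1).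
Qed.

(** The all-one vector has a positive eigenvalue, hence one different from -rho. *)
Lemma opposite_eigenspace_sum0 (e : 'rV[R]_m) :
  e *m A = - rho *: e -> e *m const_mx 1 = 0 :> 'M_1.
Proof.
move=> eA; have A1 : A *m const_mx 1 = q ^+ 'C(d, 2) *: const_mx 1 :> 'cV_m.
  rewrite -oppmx_opposite -(flag_col_full 0); apply: oppmx_fixed => [|i id].
    by rewrite d_gt0 /=.
  by apply: hecke_flag_col_off => //; lia.
have := congr1 (fun X : 'rV_m => X *m (const_mx 1 : 'cV_m)) eA.
rewrite -mulmxA A1 -scalemxAl -scalemxAr => /eqP.
rewrite -subr_eq0 -scaleNr opprK -scalerDl scaler_eq0 => /orP[|/eqP //].
by rewrite gt_eqF // addr_gt0 ?rho_gt0 // exprn_gt0 // (lt_trans _ q_gt1).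
Qed.

End EvenDimension.
End ChamberSteps.

(** * Symplectic chambers *)

Arguments step : simpl never.

Section SymplecticForm.
Variables (F : finFieldType) (n : nat).
Hypothesis n_gt0 : (0 < n)%N.
Local Notation d := (2 * n)%N.
Local Notation vT := 'rV[F]_d.
Variable f : {skew_symmetric vT}.
Hypothesis f_alt : forall u : vT, f u u = 0.
Hypothesis f_nondeg : nondegenerate f.
Implicit Types (U V W : {vspace vT}) (C D : chamber F d) (g : 'End(vT)).

Lemma n2_gt0 : (0 < d)%N. Proof. by rewrite muln_gt0. Qed.
Hint Resolve n2_gt0 : core.

Lemma skewE (u v : vT) : f u v = - f v u.
Proof. by rewrite hermC expr1 mulN1r. Qed.

Lemma orthovS U V : (U <= V)%VS -> (orthov f V <= orthov f U)%VS.
Proof.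
move=> UV; apply/subvP => x /mem_orthovP xV; apply/mem_orthovP => u uU.
exact: xV (subvP UV u uU).
Qed.

Lemma dim_cap_orthov_span U (X : seq vT) :
  (\dim U <= \dim (U :&: orthov f <<X>>) + size X)%N.
Proof.
elim: X => [|v X IHX]; first by rewrite span_nil orthov0 capvf addn0.
have -> : (U :&: orthov f <<v :: X>> = (U :&: orthov f <<X>>) :&: orthov f <[v]>)%VS.
  apply/vspaceP => x; rewrite span_cons !memv_cap -andbA; congr (_ && _).
  by rewrite !memvE orthovD andbC.
have le1 := leq_dim_orthov1 f v (U :&: orthov f <<X>>).
apply: leq_trans IHX _; rewrite [size _]/= addnS -addSn leq_add2r.
by apply: leq_trans (leqSpred _) _; rewrite ltnS.
Qed.

(** One inequality imposes the linear conditions one at a time. For the other, a vector of U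
    orthogonal to a complement of the polar of U is orthogonal to everything, hence 0; so dim U is
    at most the dimension of that complement. *)
Lemma dim_orthov U : \dim (orthov f U) = (d - \dim U)%N.
Proof.
have lb V W : (\dim V <= \dim (V :&: orthov f W) + \dim W)%N.
  by have := dim_cap_orthov_span V (vbasis W); rewrite size_tuple (span_basis (vbasisP W)).
have ge := lb fullv U; rewrite capfv dim_rVfull in ge.
have le := lb U (orthov f U)^C%VS.
suff U0 : (U :&: orthov f (orthov f U)^C = 0)%VS.
  have lec : (\dim U <= d - \dim (orthov f U))%N.
    by move: le; rewrite U0 dimv0 add0n dimv_compl dim_rVfull.
  have led : (\dim U <= d)%N by rewrite -[X in (_ <= X)%N](dim_rVfull F d) dimvS ?subvf.
  have ledo : (\dim (orthov f U) <= d)%N.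
    by rewrite -[X in (_ <= X)%N](dim_rVfull F d) dimvS ?subvf.
  have arith a b c : (c <= a + b -> b <= c - a -> b <= c -> a <= c -> a = c - b)%N by lia.
  exact: arith ge lec led ledo.
apply/eqP; rewrite -subv0 -(eqP f_nondeg); apply/subvP => x; rewrite memv_cap.
case/andP=> xU /mem_orthovP xC; apply/mem_orthovP => y _.
have /memv_addP[a aU [b bC ->]] : y \in (orthov f U + (orthov f U)^C)%VS.
  by rewrite addv_complf memvf.
by rewrite linearDr /= (xC b bC) skewE (mem_orthovP aU) // oppr0 addr0.
Qed.

Lemma orthov_nondeg (x : vT) : (forall y, f x y = 0) -> x = 0.
Proof.
move=> fx; apply/eqP; rewrite -memv0 -(eqP f_nondeg).
by apply/mem_orthovP => y _; apply: fx.
Qed.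

(** * Isometries and their action on vectors and chambers *)

Definition isometry_of g := forall x y : vT, f (g x) (g y) = f x y.

Lemma isometry_inj g : isometry_of g -> injective g.
Proof.
move=> gf x y gxy; apply/eqP; rewrite -subr_eq0; apply/eqP/orthov_nondeg => z.
by rewrite -gf linearB /= gxy subrr linear0l.
Qed.

Lemma isometry_comp g h : isometry_of g -> isometry_of h -> isometry_of (g \o h)%VF.
Proof. by move=> gf hf x y; rewrite !comp_lfunE gf. Qed.

Lemma transvection (a : F) (w : vT) :
  exists2 g, isometry_of g & forall x, g x = x + (a * f x w) *: w.
Proof.
pose t (x : vT) := x + (a * f x w) *: w.
have tlin : linear t.
  move=> c x y; rewrite /t linearDl linearZl_LR /=.
  by rewrite mulrDr scalerDl scalerDr mulrCA addrACA scalerA.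
pose T : {linear vT -> vT} := HB.pack t (GRing.isLinear.Build _ _ _ _ t tlin).
exists (linfun T) => [x y|x]; last by rewrite lfunE.
rewrite !lfunE /= /t !linearDl !linearDr /= !linearZl_LR !linearZr_LR /= f_alt.
rewrite !mulr0 addr0 [f w y]skewE; ring.
Qed.

(** The transvection along v - u, scaled by 1 / f u v, works because f u (v - u) = f u v. *)
Lemma isometry_nonorth (u v : vT) : f u v != 0 ->
  exists2 g, isometry_of g & g u = v.
Proof.
move=> uv; have [g gf gE] := transvection (f u v)^-1 (v - u).
by exists g; rewrite // gE linearBr /= f_alt subr0 mulVf // scale1r addrC subrK.
Qed.

Lemma exists_nonorth2 (u v : vT) : u != 0 -> v != 0 ->
  exists w, (f u w != 0) && (f v w != 0).
Proof.
have nz (x : vT) : x != 0 -> exists y, f x y != 0.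
  move=> x0; have := x0; rewrite -memv0 -(eqP f_nondeg) => /mem_orthovPn[y _].
  by exists y.
move=> /nz[y uy] /nz[z vz].
have [vy|vy] := eqVneq (f v y) 0; last by exists y; rewrite uy.
have [uz|uz] := eqVneq (f u z) 0; last by exists z; rewrite uz.
by exists (y + z); rewrite !linearDr /= vy uz addr0 add0r uy.
Qed.

Lemma isometry_transitive (u v : vT) : u != 0 -> v != 0 ->
  exists2 g, isometry_of g & g u = v.
Proof.
move=> u0 v0; have [w /andP[uw vw]] := exists_nonorth2 u0 v0.
have [g gf gu] := isometry_nonorth uw.
have [h hf hw] : exists2 h, isometry_of h & h w = v.
  by apply: isometry_nonorth; rewrite skewE oppr_eq0.
by exists (h \o g)%VF; [exact: isometry_comp | rewrite comp_lfunE gu].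
Qed.

Lemma memv_isometry_img g U x : isometry_of g -> (g x \in (g @: U)%VS) = (x \in U).
Proof.
move=> gf; apply/idP/idP => [/memv_imgP[y yU gxy]|]; last exact: memv_img.
by rewrite (isometry_inj gf gxy).
Qed.

Lemma dim_isometry_img g U : isometry_of g -> \dim (g @: U)%VS = \dim U.
Proof.
move=> gf; apply: limg_dim_eq; apply/eqP; rewrite -subv0; apply/subvP => x.
rewrite memv_cap memv_ker => /andP[_ /eqP gx].
by rewrite memv0; apply/eqP/(isometry_inj gf); rewrite gx linear0.
Qed.

Lemma orthov_isometry_img g U : isometry_of g ->
  (orthov f (g @: U) = g @: orthov f U)%VS.
Proof.
move=> gf; apply/eqP; rewrite eq_sym eqEdim; apply/andP; split.
  apply/subvP => _ /memv_imgP[x xU ->]; apply/mem_orthovP => _ /memv_imgP[y yU ->].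
  by rewrite gf (mem_orthovP xU).
by rewrite dim_isometry_img // !dim_orthov dim_isometry_img.
Qed.

Lemma chamber_img g C : isometry_of g ->
  exists D, forall j, (j <= d)%N -> step D j = (g @: step C j)%VS.
Proof.
move=> gf; have [|j _ _|D DE] := @chamber_of_steps F d n2_gt0 (fun j => g @: step C j)%VS.
- by move=> j /andP[_ jd]; rewrite dim_isometry_img ?dim_step // ltnW.
- by apply: limgS; apply: step_le.
exists D => j jd; have [->|j0] := posnP j; first by rewrite !step0 limg0.
have [dj|ltjd] := leqP d j; last by apply: DE; rewrite j0.
by apply/eqP; rewrite step_full // eq_sym eqEdim subvf dim_isometry_img // step_full /=.
Qed.

(** A total function: for an isometry [chamber_img] supplies the image chamber, so the default C is
    never taken. *)
Definition chamber_act g C : chamber F d :=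
  odflt C [pick D : chamber F d | [forall j : 'I_d, step D j == (g @: step C j)%VS]].

Lemma step_act g C j : isometry_of g -> (j < d)%N ->
  step (chamber_act g C) j = (g @: step C j)%VS.
Proof.
move=> gf jd; rewrite /chamber_act; case: pickP => [D /forallP/(_ (Ordinal jd))/eqP //|no].
have [D DE] := chamber_img C gf.
by have /forallP[] := negbT (no D) => i; rewrite DE // ltnW.
Qed.

Lemma chamber_act_inj g : isometry_of g -> injective (chamber_act g).
Proof.
move=> gf C D CD; apply: (chamber_eq n2_gt0) => j /andP[_ jd].
apply/vspaceP => x; rewrite -(memv_isometry_img _ _ gf) -step_act // CD step_act //.
exact: memv_isometry_img.
Qed.

Lemma symplecticP C : reflect
  (forall j, (j <= n)%N -> step C (d - j) = orthov f (step C j)) (symplectic f C).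
Proof.
apply: (iffP andP) => [[_ /forallP so] j jn|so].
  have [->|j0] := posnP j; first by rewrite subn0 step0 orthov0 step_full.
  have jd : (j.-1 < d.-1)%N by lia.
  have /implyP := so (Ordinal jd); rewrite -!stepS /= => /(_ _)/eqP.
  have -> : (d.-1 - j.-1.+1).+1 = (d - j)%N by lia.
  by rewrite (prednK j0); apply; lia.
have so' i : (i < n)%N -> forall id : (i < d.-1)%N,
    C (rev_ord (Ordinal id)) = orthov f (C (Ordinal id)).
  move=> lein id; rewrite -!stepS /= -so //.
  by congr (step C _); lia.
split; apply/forallP => -[i id]; apply/implyP => /= lin; last by rewrite so'.
rewrite -[X in (X <= _)%VS]stepS -stepS /= (eqP lin) -so //.
by have -> : (d - n = n)%N by lia.
Qed.

Lemma symplectic_act g C : isometry_of g -> symplectic f C ->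
  symplectic f (chamber_act g C).
Proof.
move=> gf /symplecticP so; apply/symplecticP => j jn.
have [->|j0] := posnP j; first by rewrite subn0 step0 orthov0 step_full.
by rewrite !step_act // ?so ?orthov_isometry_img //; lia.
Qed.

Section InvariantFamily.
Variable S : pred (chamber F d).
Hypothesis S_act : forall g C, isometry_of g -> S C -> S (chamber_act g C).

Lemma card_mem_step_le j (u v : vT) : (j < d)%N -> u != 0 -> v != 0 ->
  (#|[pred C | S C & u \in step C j]| <= #|[pred C | S C & v \in step C j]|)%N.
Proof.
move=> jd u0 v0; have [g gf gu] := isometry_transitive u0 v0.
rewrite -(card_image (chamber_act_inj gf)); apply: subset_leq_card.
apply/subsetP => _ /imageP[C /andP[SC uC] ->]; rewrite inE S_act //=.
by rewrite step_act // -gu memv_isometry_img.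
Qed.

(** Count pairs (C, v) with C in S and v a nonzero vector of C_j; by transitivity the number of C
    does not depend on v. *)
Lemma card_mem_step j (u : vT) : (j <= d)%N -> u != 0 ->
  (#|[pred C | S C & u \in step C j]| * (#|F| ^ d - 1) = #|S| * (#|F| ^ j - 1))%N.
Proof.
move=> jd u0; have card_nz V : #|[pred v : vT | (v != 0%R) && (v \in V)]| = (#|F| ^ \dim V - 1)%N.
  have <- := card_mem_vspace V; rewrite [in RHS](cardD1 0) inE mem0v addKn.
  by apply: eq_card => v; rewrite !inE.
have := card_nz fullv; rewrite dim_rVfull => card_full.
transitivity (\sum_(v : vT | v != 0%R) #|[pred C | S C & v \in step C j]|)%N.
  rewrite (eq_bigr (fun=> #|[pred C | S C & u \in step C j]|)) => [|v v0].
    rewrite -card_full mulnC -sum_nat_const; apply: eq_bigl => v.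
    by rewrite inE memvf andbT.
  have [dj|ltjd] := leqP d j.
    by apply: eq_card => C; rewrite !inE !step_full // !memvf.
  by apply/eqP; rewrite eqn_leq !card_mem_step_le.
under eq_bigr => v _ do rewrite -sum1_card.
rewrite (exchange_big_dep S) /=; last by move=> v C _ /andP[].
rewrite -sum_nat_const; apply: eq_bigr => C SC.
rewrite -[j in RHS](dim_step n2_gt0 C jd) -card_nz -sum1_card; apply: eq_bigl => v.
by rewrite !inE SC.
Qed.

End InvariantFamily.

(** * The antidesign property *)

Section Antidesign.
Variable R : rcfType.
Local Notation m := #|{: chamber F d}|.
Local Notation q := (#|F|%:R : R).

(** The mean of v_f; by [card_mem_step] for symplectic and for all chambers, v_f minus this constant
    is orthogonal to every [flag_col] of a nonzero vector. *)
Let density : R := #|symplectic f|%:R / #|{: chamber F d}|%:R.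

Lemma symplectic_flag_orth j (u : vT) : (j <= d)%N -> u != 0 ->
  (\row_(a < m) ((symplectic f (enum_val a))%:R - density)) *m flag_col R j u = 0.
Proof.
move=> jd u0; apply/matrixP => i k; rewrite !mxE.
pose g C : R := ((symplectic f C)%:R - density) * (u \in step C j)%:R.
transitivity (\sum_(a < m) g (enum_val a)); first by apply: eq_bigr => a _; rewrite !mxE.
rewrite sum_chamber /g; have qd : (#|F| ^ d - 1)%:R != 0 :> R.
  rewrite pnatr_eq0 -lt0n subn_gt0 -{1}(exp1n d) ltn_exp2r //.
  exact: finNzRing_gt1.
apply: (mulIf qd); rewrite mul0r.
have -> : \sum_C ((symplectic f C)%:R - density) * (u \in step C j)%:R =
    #|[pred C | symplectic f C & u \in step C j]|%:R -
    density * #|[pred C : chamber F d | true & u \in step C j]|%:R.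
  rewrite -!sum_natr_bool mulr_sumr -sumrB; apply: eq_bigr => C _ /=.
  by rewrite mulrBl -natrM mulnb.
rewrite mulrBl -mulrA -!natrM (card_mem_step symplectic_act) //.
rewrite (@card_mem_step predT) // !natrM mulrA /density.
have [E|N0] := posnP #|{: chamber F d}|.
  have -> : #|symplectic f| = 0%N.
    by have := max_card (symplectic f); rewrite E leqn0 => /eqP.
  by rewrite !mul0r subrr.
by rewrite divfK ?subrr // pnatr_eq0 -lt0n.
Qed.

Lemma symplectic_antidesign (C0 : chamber F d) :
  antidesign R (@opposite F d) (symplectic_fun f).
Proof.
exists (- (q ^+ (2 * n * n.-1))).
  split; first exact: opposite_eigenvalue.
  by move=> l; apply: opposite_eigenvalue_ge.
move=> e /eigenspaceP eA.
have := opposite_eigenspace_orth n2_gt0 n_gt0 erefl symplectic_flag_orth eA.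
have := opposite_eigenspace_sum0 n2_gt0 n_gt0 erefl eA.
move=> /matrixP/(_ 0 0); rewrite !mxE => e1 /matrixP/(_ 0 0); rewrite !mxE => ev.
rewrite (reindex _ (onW_bij _ (@enum_val_bij (chamber F d)))) /=.
(* Both v_f - density and the constant part are orthogonal to e. *)
transitivity (\sum_a (e 0 a * ((symplectic f (enum_val a))%:R - density)
                      + density * (e 0 a * 1))).
  apply: eq_bigr => a _; rewrite enum_valK /symplectic_fun ratr_nat; ring.
rewrite big_split /= -mulr_sumr.
have -> : \sum_a e 0 a * 1 = 0.
  by rewrite -[RHS]e1; apply: eq_bigr => a _; rewrite mxE.
rewrite mulr0 addr0 -[RHS]ev; apply: eq_bigr => a _; by rewrite !mxE.
Qed.

End Antidesign.

(** * Counting symplectic chambers by adapted bases *)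

Fixpoint isotropic_free (s : seq vT) : bool :=
  if s is v :: s' then
    [&& v \in orthov f <<s'>>, v \notin <<s'>>%VS & isotropic_free s']
  else true.

(** Lists grow at the head, so the last j vectors of an adapted list span C_j. *)
Fixpoint adapted C (s : seq vT) : bool :=
  if s is v :: s' then
    [&& v \in step C (size s').+1, v \notin step C (size s') & adapted C s']
  else true.

Lemma isotropic_free_drop k s : isotropic_free s -> isotropic_free (drop k s).
Proof. by elim: s k => [|v s IHs] [|k] //= /and3P[_ _ /IHs]; apply. Qed.

Lemma isotropic_free_dim s : isotropic_free s -> \dim <<s>> = size s.
Proof.
move=> sP; apply/eqP; rewrite -/(free s); elim: s sP => [|v s IHs] /=; first by rewrite nil_free.
by case/and3P=> _ vs /IHs fs; rewrite free_cons vs.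
Qed.

Lemma isotropic_free_orthov s : isotropic_free s -> (<<s>> <= orthov f <<s>>)%VS.
Proof.
elim: s => [|v s IHs] /=; first by rewrite span_nil sub0v.
case/and3P=> vs _ /IHs so; rewrite span_cons orthoDv !orthovD orthov11 f_alt eqxx so.
by rewrite andbT /= [X in _ && X]orthov_sym andbb -memvE.
Qed.

Lemma adapted_span C s : (size s <= d)%N -> adapted C s -> <<s>>%VS = step C (size s).
Proof.
elim: s => [|v s IHs] /=; first by rewrite span_nil step0.
move=> sd /and3P[vS vN /IHs sE]; rewrite span_cons sE; last exact: ltnW.
apply/eqP; rewrite eqEdim subv_add -memvE vS step_le //= dim_step //.
rewrite addvC dimv_disjoint_sum ?dim_step ?(ltnW sd) //; last first.
  apply/eqP; rewrite -subv0; apply/subvP => x; rewrite memv_cap memv0.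
  case/andP => xC /vlineP[a xa]; apply: contraNT vN; rewrite xa scaler_eq0 negb_or.
  by case/andP=> a0 _; rewrite -[v](scalerK a0) memvZ // -xa.
rewrite dim_vline (_ : v != 0) ?addn1 //.
by apply: contraNneq vN => ->; apply: mem0v.
Qed.

Lemma adapted_isotropic C s : symplectic f C -> (size s <= n)%N ->
  adapted C s -> isotropic_free s.
Proof.
move=> /symplecticP so; elim: s => //= v s IHs sn /and3P[vS vN sA].
have sE := adapted_span (_ : (size s <= d)%N) sA; rewrite sE; last by lia.
rewrite vN IHs ?(ltnW sn) // !andbT.
have Cn : (step C n <= orthov f (step C n))%VS.
  by rewrite -so // step_le //; lia.
have CnO := subv_trans Cn (orthovS (step_le n2_gt0 C (ltnW sn))).
exact: (subvP CnO) _ (subvP (step_le n2_gt0 C sn) v vS).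
Qed.

Lemma adapted_drop C k s : adapted C s -> adapted C (drop k s).
Proof. by elim: s k => [|v s IHs] [|k] //= /and3P[_ _ /IHs]; apply. Qed.

(** The suffixes of s determine C_j for j <= n, and polarity determines the rest. *)
Lemma symplectic_adapted_unique C D s : symplectic f C -> symplectic f D ->
  size s = n -> adapted C s -> adapted D s -> C = D.
Proof.
move=> /symplecticP Co /symplecticP Do sn Cs Ds.
have low j : (j <= n)%N -> step C j = step D j.
  move=> jn; have sj : size (drop (n - j) s) = j by rewrite size_drop sn subKn.
  have spanE E : adapted E s -> <<drop (n - j) s>>%VS = step E j.
    by move=> Es; rewrite (adapted_span _ (adapted_drop _ Es)) sj //; lia.
  by rewrite -!spanE.
apply: (chamber_eq n2_gt0) => j /andP[j0 jd]; have [jn|nj] := leqP j n; first exact: low.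
have -> : j = (d - (d - j))%N by lia.
have jn : (d - j <= n)%N by lia.
by rewrite (Co _ jn) (Do _ jn) low.
Qed.

Lemma symplectic_adapted_exists s : size s = n -> isotropic_free s ->
  exists2 C, symplectic f C & adapted C s.
Proof.
move=> sn sI; pose V j := <<drop (n - j) s>>%VS.
have dimV j : (j <= n)%N -> \dim (V j) = j.
  by move=> jn; rewrite isotropic_free_dim ?isotropic_free_drop // size_drop sn subKn.
have V_le i j : (i <= j)%N -> (V i <= V j)%VS.
  move=> ij; apply: sub_span => x; have -> : (n - i = (n - i - (n - j)) + (n - j))%N by lia.
  by rewrite -drop_drop; apply: mem_drop.
have Vn : (V n <= orthov f (V n))%VS.
  by apply: isotropic_free_orthov; apply: isotropic_free_drop.
(* The lower half consists of spans of suffixes and the upper half of their polars; they fit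
   together at n since V n is totally isotropic. *)
have [j jd|j j0 jd|C CE] := @chamber_of_steps F d n2_gt0
    (fun j => if (j <= n)%N then V j else orthov f (V (d - j)%N)).
- by case: leqP => jn; rewrite ?dim_orthov dimV //; lia.
- case: (leqP j n) => jn; case: (leqP j.+1 n) => j1n; try lia.
  + exact: V_le.
  + have -> : j = n by lia.
    by apply: subv_trans Vn _; apply: orthovS; apply: V_le; lia.
  + by apply: orthovS; apply: V_le; lia.
have low j : (j <= n)%N -> step C j = V j.
  move=> jn; have [->|j0] := posnP j; last by rewrite CE ?jn //; lia.
  by apply/esym/eqP; rewrite step0 -dimv_eq0 dimV.
exists C.
  apply/symplecticP => j jn; rewrite (low j jn).
  have [->|j0] := posnP j.
    have V0 : V 0 = 0%VS by apply/eqP; rewrite -dimv_eq0 dimV.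
    by rewrite V0 orthov0 step_full ?subn0.
  have [jltn|nj] := ltnP j n; last first.
    have -> : j = n by lia.
    have -> : (d - n = n)%N by lia.
    by rewrite low //; apply/eqP; rewrite eqEdim Vn dim_orthov dimV //; lia.
  rewrite CE; last by lia.
  by rewrite ifF ?subKn //; lia.
suff A k : (k <= n)%N -> adapted C (drop (n - k) s).
  by have := A n (leqnn n); rewrite subnn drop0.
elim: k => [|k IHk] kn; first by rewrite subn0 drop_oversize ?sn.
have ks : (n - k.+1 < size s)%N by rewrite sn; lia.
have nk : (n - k.+1).+1 = (n - k)%N by lia.
have := isotropic_free_drop (n - k.+1) sI.
have := low k.+1 kn; rewrite /V (drop_nth 0 ks) nk /=.
have -> : size (drop (n - k) s) = k by rewrite size_drop sn subKn // ltnW.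
move=> -> /and3P[_ vN _]; rewrite memv_span ?mem_head //= IHk ?(ltnW kn) // andbT.
by rewrite low ?(ltnW kn).
Qed.

Lemma sum_tuple_cons (T : finType) k (G : seq T -> nat) :
  (\sum_(t : k.+1.-tuple T) G t = \sum_(t : k.-tuple T) \sum_v G (v :: t))%N.
Proof.
rewrite pair_big /= (reindex (fun p : k.-tuple T * T => [tuple of p.2 :: p.1])) //=.
exists (fun t : k.+1.-tuple T => ([tuple of behead t], thead t)) => [[t v] _|t _] /=.
  by congr pair; apply: val_inj.
by rewrite -tuple_eta.
Qed.

Lemma sum_mem_diff U V : (U <= V)%VS ->
  (\sum_v ((v \in V) && (v \notin U)) = #|F| ^ \dim V - #|F| ^ \dim U)%N.
Proof.
move=> UV; have cnt W : (\sum_v (v \in W) = #|F| ^ \dim W)%N.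
  by rewrite -card_mem_vspace -sum1_card [RHS]big_mkcond; apply: eq_bigr => v _; rewrite inE; case: (v \in W).
rewrite -!cnt -sumnB => [|v _]; last first.
  by case: (boolP (v \in U)) => // /(subvP UV) ->.
apply: eq_bigr => v _; case: (boolP (v \in U)) => [/(subvP UV) -> //|_].
by case: (v \in V).
Qed.

Lemma count_adapted C k : (k <= n)%N ->
  (\sum_(t : k.-tuple vT) adapted C t = \prod_(i < k) (#|F| ^ i.+1 - #|F| ^ i))%N.
Proof.
elim: k => [|k IHk] kn.
  rewrite big_ord0 (eq_bigr (fun=> 1%N)) => [|t _]; last by rewrite tuple0.
  by rewrite sum1_card card_tuple.
rewrite (sum_tuple_cons _ (fun s => nat_of_bool (adapted C s))) big_ord_recr /= -IHk ?(ltnW kn) // big_distrl /=.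
apply: eq_bigr => t _; rewrite size_tuple.
have dk : (k.+1 <= d)%N by lia.
have := sum_mem_diff (step_le n2_gt0 C (leqnSn k)); rewrite !dim_step ?(ltnW dk) // => <-.
rewrite big_distrr /=; apply: eq_bigr => v _.
by rewrite mulnb andbA andbC.
Qed.

(** After i vectors, the next one lies in the polar of their span, of dimension d - i, but outside
    the span itself, which the polar contains. *)
Lemma count_isotropic k : (k <= n)%N ->
  (\sum_(t : k.-tuple vT) isotropic_free t =
   \prod_(i < k) (#|F| ^ (d - i) - #|F| ^ i))%N.
Proof.
elim: k => [|k IHk] kn.
  rewrite big_ord0 (eq_bigr (fun=> 1%N)) => [|t _]; last by rewrite tuple0.
  by rewrite sum1_card card_tuple.
rewrite (sum_tuple_cons _ (fun s => nat_of_bool (isotropic_free s))) big_ord_recr /= -IHk ?(ltnW kn) // big_distrl /=.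
apply: eq_bigr => t _; have [tI|_] := boolP (isotropic_free t); last first.
  by rewrite mul0n big1 // => v _; rewrite !andbF.
have := sum_mem_diff (isotropic_free_orthov tI).
rewrite dim_orthov isotropic_free_dim // size_tuple mul1n => <-.
by apply: eq_bigr => v _; rewrite andbT.
Qed.

(* Count the pairs (C, s) with s an adapted basis of the member C_n of C. *)
Lemma card_symplectic :
  (#|symplectic f| * \prod_(i < n) (#|F| ^ i.+1 - #|F| ^ i) =
   \prod_(i < n) (#|F| ^ (d - i) - #|F| ^ i))%N.
Proof.
rewrite -count_isotropic // -sum_nat_const.
under eq_bigr => C _ do rewrite -(count_adapted C (leqnn n)).
rewrite exchange_big /=; apply: eq_bigr => t _.
have [tI|tN] := boolP (isotropic_free t); last first.
  rewrite big1 // => C SC; apply/eqP; rewrite eqb0.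
  by apply: contra tN; apply: adapted_isotropic; rewrite ?size_tuple.
have [C SC Ct] := symplectic_adapted_exists (size_tuple t) tI.
rewrite (bigD1 C) //= Ct big1 // => D /andP[SD DC]; apply/eqP; rewrite eqb0.
by apply: contra DC => Dt; apply/eqP; apply: symplectic_adapted_unique Dt Ct; rewrite ?size_tuple.
Qed.

Local Notation q := (#|F|%:R : rat).

Lemma sum_symplectic_fun :
  \sum_(C : chamber F d) symplectic_fun f C =
    num_chambers n #|F| * \prod_(1 <= i < n.+1) (q ^+ i + 1).
Proof.
have q1 : 1 < q by rewrite (ltr_nat _ 1) finNzRing_gt1.
have q0 : q != 0 by rewrite gt_eqF // (lt_trans _ q1).
have qm1 : q - 1 != 0 by rewrite subr_eq0 gt_eqF.
transitivity (#|symplectic f|%:R : rat); first exact: sum_natr_bool.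
have := congr1 (fun k => k%:R : rat) card_symplectic.
rewrite natrM !natr_prod.
have expB i j : (i <= j)%N -> (#|F| ^ j - #|F| ^ i)%:R = q ^+ i * (q ^+ (j - i) - 1).
  move=> ij; rewrite natrB ?leq_exp2l ?finNzRing_gt1 // !natrX mulrBr mulr1 -exprD.
  by rewrite subnKC.
rewrite (eq_bigr (fun i : 'I_n => q ^+ i * (q - 1))); last first.
  by move=> i _; rewrite expB // subSnn expr1.
rewrite [RHS](eq_bigr (fun i : 'I_n => q ^+ i * (q ^+ (2 * (n - i)) - 1))); last first.
  move=> i _; have := ltn_ord i => lin; rewrite expB; last by lia.
  by congr (_ * (_ ^+ _ - _)); lia.
rewrite !big_split /= mulrCA => /mulfI; have /[swap]/[apply] : \prod_(i < n) q ^+ i != 0.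
  by apply/prodf_neq0 => i _; rewrite expf_neq0.
rewrite prodr_const card_ord => e.
have qn : (q - 1) ^+ n != 0 by rewrite expf_neq0.
apply: (mulIf qn); rewrite e /num_chambers [RHS]mulrC !mulrA divff // mul1r.
(* Reverse the index and factor q^(2i) - 1 = (q^i - 1)(q^i + 1). *)
rewrite -big_split /= big_add1 /= big_mkord (reindex_inj rev_ord_inj) /=.
apply: eq_bigr => i _; have lin := ltn_ord i.
have -> : (n - (n - i.+1) = i.+1)%N by lia.
by rewrite mulnC exprM; ring.
Qed.

(** Without chambers the count would be 0, yet every factor q^(d-i) - q^i with i < n is positive. *)
Lemma exists_chamber : chamber F d.
Proof.
have [C _|no] := pickP (fun _ : chamber F d => true); first exact: C.
exfalso; have := card_symplectic; rewrite eq_card0 => [|C]; last by have := no C.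
rewrite mul0n => /esym/eqP; rewrite -leqn0 leqNgt => /negP; apply.
apply: prodn_gt0 => i; have lin := ltn_ord i.
by rewrite subn_gt0 ltn_exp2l ?finNzRing_gt1 //; lia.
Qed.

End SymplecticForm.

Theorem theorem3p9 (R : rcfType) (F : finFieldType) (n : nat) (n_ge1 : (1 <= n)%N)
    (f : {skew_symmetric 'rV[F]_(2 * n)})
    (f_alternating : forall u : 'rV[F]_(2 * n), f u u = 0)
    (f_nondegenerate : nondegenerate f) :
  antidesign R (@opposite F (2 * n)) (symplectic_fun f) /\
  \sum_(C : chamber F (2 * n)) symplectic_fun f C =
    num_chambers n #|F| * \prod_(1 <= i < n.+1) (#|F|%:R ^+ i + 1).
Proof.
split; last exact: sum_symplectic_fun.
by apply: symplectic_antidesign => //; apply: exists_chamber.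
Qed.
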